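(* Let $\mathcal{Q}$ be an abstract polyhedron which is a map on the sphere or on the Euclidean plane, let $\Phi$ be a flag of $\mathcal{Q}$ (the base flag), and let $\Gamma=\langle\rho_0,\rho_1,\rho_2\rangle$ be a string C-group of rank $3$ admitting a flag action on $\mathcal{Q}$. Then $\mathrm{Stab}_\Gamma(\Phi)$ is generated by the set of all elements $$W_v=w_v(\rho_1\rho_2)^{q_v}w_v^{-1}\quad\text{and}\quad W_f=w_f(\rho_0\rho_1)^{p_f}w_f^{-1},$$ where $v$ ranges over the vertices of $\mathcal{Q}$, $q_v$ is the degree of $v$, $f$ ranges over the faces of $\mathcal{Q}$, $p_f$ is the number of edges of $f$, and $w_v$ (resp. $w_f$) ranges over the elements of $\Gamma$ such that $\Phi^{w_v}$ contains $v$ (resp. $\Phi^{w_f}$ contains $f$).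
   Context: An abstract polyhedron is an abstract polytope of rank $3$ (vertices, edges, faces of ranks $0,1,2$; flags are maximal chains; diamond condition holds). For a flag $\Psi$ and $i\in\{0,1,2\}$, $\Psi^i$ is the unique flag differing from $\Psi$ exactly in its rank-$i$ face. A string C-group of rank 3 is a group generated by involutions $\rho_0,\rho_1,\rho_2$ with $(\rho_0\rho_2)^2=\varepsilon$ and $\langle\rho_0,\rho_1\rangle\cap\langle\rho_1,\rho_2\rangle=\langle\rho_1\rangle$. A flag action of $\Gamma$ on $\mathcal{Q}$ is a homomorphism from $\Gamma$ into the permutations of flags with $\rho_i$ acting by $\Psi\mapsto\Psi^i$, written as a right action: $\Psi^{w\rho_i}=(\Psi^w)^i$. The degree of a vertex is the number of edges containing it. $\mathrm{Stab}_\Gamma(\Phi)=\{g\in\Gamma:\Phi^g=\Phi\}$. *)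

(* Defs.v *)
From HB Require Import structures.
From mathcomp Require Import all_boot all_order all_algebra.
From mathcomp Require Import monoid.
From mathcomp Require Import all_classical all_reals all_analysis.
Set Implicit Arguments.
Unset Strict Implicit.
Unset Printing Implicit Defensive.

Import Order.TTheory GRing.Theory Num.Theory.
Import numFieldNormedType.Exports.

Local Open Scope classical_set_scope.
Local Open Scope card_scope.
Local Open Scope ring_scope.

(** * Abstract polytopes *)

Definition chain (d : Order.disp_t) (Q : porderType d) (C : set Q) : Prop :=
  total_on C (fun F G => (F <= G)%O).

Definition is_flag (d : Order.disp_t) (Q : porderType d) (C : set Q) : Prop :=
  chain C /\ (forall D : set Q, chain D -> C `<=` D -> D = C).

Definition flag (d : Order.disp_t) (Q : porderType d) : Type :=
  {C : set Q | is_flag C}.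

(** [i_adjacent rk i Psi Psi'] says that [Psi'] is the flag written Psi^i in the
    literature; its existence and uniqueness, for 0 <= i < n, follow from the
    diamond condition. *)
Definition i_adjacent (d : Order.disp_t) (Q : porderType d) (rk : Q -> int)
    (i : int) (Psi Psi' : flag Q) : Prop :=
  Psi <> Psi' /\ (forall F : Q, rk F <> i -> sval Psi F <-> sval Psi' F).

(** An abstract polytope of rank [n]; the least and greatest faces are the
    bottom and top elements of [Q]. *)
Record abstract_polytope (n : nat) (d : Order.disp_t) (Q : tbPOrderType d)
    (rk : Q -> int) : Prop := AbstractPolytope {
  rank_range : forall F : Q, -1 <= rk F <= n%:Z ;
  rank_mono : forall F G : Q, (F < G)%O -> rk F < rk G ;
  flag_card : forall Psi : flag Q, sval Psi #= `I_n.+2 ;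
  (* strong flag-connectedness *)
  flag_connected : forall Phi Psi : flag Q,
    exists (m : nat) (Theta : nat -> flag Q),
      [/\ Theta 0%N = Phi, Theta m = Psi,
          (forall k, (k < m)%N ->
             exists i : int, i_adjacent rk i (Theta k) (Theta k.+1)) &
          (forall k, (k <= m)%N ->
             sval Phi `&` sval Psi `<=` sval (Theta k))] ;
  diamond : forall F G : Q, (F < G)%O -> rk G = rk F + 2 ->
    [set H : Q | (F < H)%O && (H < G)%O] #= `I_2
}.

Definition abstract_polyhedron (d : Order.disp_t) (Q : tbPOrderType d)
    (rk : Q -> int) : Prop := abstract_polytope 3 rk.

Definition edges_at (d : Order.disp_t) (Q : porderType d) (rk : Q -> int)
    (v : Q) : set Q := [set e | rk e = 1 /\ (v < e)%O].

Definition edges_of (d : Order.disp_t) (Q : porderType d) (rk : Q -> int)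
    (f : Q) : set Q := [set e | rk e = 1 /\ (e < f)%O].

(** * Maps on surfaces *)

Definition homeomorphic (T U : topologicalType) (A : set T) (B : set U) :
    Prop :=
  exists (f : T -> U) (g : U -> T),
    [/\ {within A, continuous f}, {within B, continuous g},
        (forall x, A x -> B (f x) /\ g (f x) = x) &
        (forall y, B y -> A (g y) /\ f (g y) = y)].

Definition proper_face (Q : Type) (rk : Q -> int) (F : Q) : Prop :=
  0 <= rk F <= 2.

(** A polyhedron [Q] is a map on the surface [X] when [X] has a locally finite
    decomposition into open cells (points, open arcs and open discs), indexed
    by the vertices, edges and faces of [Q], in which the closure of a cell is
    the union of the cells of the faces of [Q] below it. *)
Definition map_on (R : realType) (d : Order.disp_t) (Q : porderType d)
    (rk : Q -> int) (T : topologicalType) (X : set T) : Prop :=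
  exists cell : Q -> set T,
    [/\ (forall (F : Q) (i : nat), proper_face rk F -> rk F = i%:Z ->
           homeomorphic (cell F) [set: 'rV[R]_i]),
        X = \bigcup_(F in proper_face rk) cell F,
        (forall F G : Q, proper_face rk F -> proper_face rk G ->
           cell F `&` cell G !=set0 -> F = G),
        (forall G : Q, proper_face rk G ->
           closure (cell G) `&` X =
             \bigcup_(F in [set F | proper_face rk F /\ (F <= G)%O]) cell F) &
        (forall x : T, X x -> exists2 U : set T, nbhs x U &
           finite_set [set F | proper_face rk F /\ cell F `&` U !=set0])].

Definition unit_sphere (R : realType) : set 'rV[R]_3 :=
  [set x : 'rV[R]_3 | \sum_(i < 3) x 0 i ^+ 2 = 1].

Definition euclidean_plane (R : realType) : set 'rV[R]_2 := [set: 'rV[R]_2].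

Arguments unit_sphere R : clear implicits.
Arguments euclidean_plane R : clear implicits.

(** * String C-groups and flag actions *)

Definition subgroup (G : groupType) (H : set G) : Prop :=
  [/\ H 1%g, (forall x y, H x -> H y -> H (x * y)%g) &
      (forall x, H x -> H (x^-1)%g)].

Definition generated (G : groupType) (A : set G) : set G :=
  \bigcap_(H in [set H | subgroup H /\ A `<=` H]) H.

Definition involution (G : groupType) (x : G) : Prop :=
  x <> 1%g /\ (x * x)%g = 1%g.

Record string_C_group (G : groupType) (r0 r1 r2 : G) : Prop := StringCGroup {
  involution0 : involution r0 ;
  involution1 : involution r1 ;
  involution2 : involution r2 ;
  generators : generated [set r0; r1; r2] = [set: G] ;
  string_relation : ((r0 * r2) ^+ 2)%g = 1%g ;
  intersection_property :
    generated [set r0; r1] `&` generated [set r1; r2] = generated [set r1]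
}.

(** [act Psi w] is Psi^w, a right action. *)
Record flag_action (d : Order.disp_t) (Q : porderType d) (rk : Q -> int)
    (G : groupType) (r0 r1 r2 : G) (act : flag Q -> G -> flag Q) : Prop :=
  FlagAction {
    act_one : forall Psi, act Psi 1%g = Psi ;
    act_mul : forall Psi (x y : G), act Psi (x * y)%g = act (act Psi x) y ;
    act_gen0 : forall Psi, i_adjacent rk 0 Psi (act Psi r0) ;
    act_gen1 : forall Psi, i_adjacent rk 1 Psi (act Psi r1) ;
    act_gen2 : forall Psi, i_adjacent rk 2 Psi (act Psi r2)
  }.

Definition stabilizer (d : Order.disp_t) (Q : porderType d) (G : groupType)
    (act : flag Q -> G -> flag Q) (Phi : flag Q) : set G :=
  [set g | act Phi g = Phi].

Definition vertex_words (d : Order.disp_t) (Q : porderType d) (rk : Q -> int)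
    (G : groupType) (r1 r2 : G) (act : flag Q -> G -> flag Q) (Phi : flag Q) :
    set G :=
  [set W | exists (v : Q) (q : nat) (w : G),
     [/\ rk v = 0, edges_at rk v #= `I_q, sval (act Phi w) v &
         W = (w * (r1 * r2) ^+ q * w^-1)%g]].

(** [map_on] does not exclude faces of the plane with infinitely many edges;
    such a face has no exponent [p] and contributes no element. *)
Definition face_words (d : Order.disp_t) (Q : porderType d) (rk : Q -> int)
    (G : groupType) (r0 r1 : G) (act : flag Q -> G -> flag Q) (Phi : flag Q) :
    set G :=
  [set W | exists (f : Q) (p : nat) (w : G),
     [/\ rk f = 2, edges_of rk f #= `I_p, sval (act Phi w) f &
         W = (w * (r0 * r1) ^+ p * w^-1)%g]].

(* Main.v *)
Require Import Defs.
From HB Require Import structures.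
From mathcomp Require Import all_boot all_order all_algebra.
From mathcomp Require Import monoid.
From mathcomp Require Import all_classical all_reals all_analysis.
From mathcomp Require Import lra ring zify.
(** Let N be the subgroup generated by the words W_v and W_f.  The cosets N g,
    with N g sent to the flag Phi^g, form a covering of the flag graph, and it
    has to be shown that this covering has one sheet.  The components of the
    preimage of the flags through a proper face F are the double cosets
    N w <rho_j : j <> rk F>.  A full rotation about a vertex or a face, and
    (rho_0 rho_2)^2 about an edge, lies in N up to conjugation, so each
    component maps bijectively to the flags through F, and the components form
    a local system on the poset of proper faces.  Sending a point of the
    surface to the face whose open cell contains it is lower semicontinuous, so
    this becomes a locally constant sheaf on the surface.  Such a sheaf has
    global sections: on the plane by gluing over rectangles, on the sphere by
    gluing two stereographic charts along their connected intersection.  A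
    global section is constant on cells, hence yields a section of the
    covering, so that every g fixing Phi lies in N. *)

Set Implicit Arguments.
Unset Strict Implicit.
Unset Printing Implicit Defensive.

Import Order.TTheory GRing.Theory Num.Theory.
Import numFieldNormedType.Exports.

Local Open Scope classical_set_scope.
Local Open Scope card_scope.
Local Open Scope ring_scope.

(** * Connectedness and induction along an interval *)

(** The hypothesis makes [B] locally constant along [A], so the part of [A] inside [B] is both open
    and closed relative to [A]. *)
Lemma connected_near (Y : topologicalType) (A B : set Y) (y0 : Y) :
  connected A ->
  (forall y, A y -> \forall z \near y, A z -> (B y <-> B z)) ->
  A y0 -> B y0 -> A `<=` B.
Proof.
move=> cA locB Ay0 By0.
have H : A `&` B = A.
  apply: cA; first by exists y0.
  - exists (interior [set z | A z -> B z]); first exact: open_interior.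
    apply/seteqP; split=> y [Ay By]; split=> //.
      by apply: filterS (locB _ Ay) => z zB Az; apply/(zB Az).
    exact: (interior_subset By).
  - exists (~` (interior [set z | A z -> ~ B z])).
      by apply: open_closedC; exact: open_interior.
    apply/seteqP; split=> y [Ay By]; split=> //.
      by move/interior_subset => /(_ Ay).
    apply: contrapT => nBy; apply: By.
    by apply: filterS (locB _ Ay) => z zB Az /(zB Az).
by rewrite -H; apply: subIsetr.
Qed.

(** [A] is a union of segments issuing from [c]. *)
Lemma starshaped_connected (R : realType) (V : normedModType R) (A : set V)
    (c : V) :
  A c -> (forall p t, A p -> 0 <= t <= 1 -> A (c + t *: (p - c))) ->
  connected A.
Proof.
move=> Ac starA.
have -> : A = \bigcup_(p in A) ((fun t : R => c + t *: (p - c)) @` `[0, 1]).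
  apply/seteqP; split=> [p Ap|_ [p Ap [t /= + <-]]].
    exists p => //; exists 1 => /=; first by rewrite in_itv /= ler01 lexx.
    by rewrite scale1r addrC subrK.
  by rewrite in_itv /= => t01; apply: starA.
apply: bigcup_connected.
  exists c => p Ap; exists 0 => /=; first by rewrite in_itv /= ler01 lexx.
  by rewrite scale0r addr0.
move=> p Ap; apply: connected_continuous_connected; first exact: segment_connected.
apply: continuous_subspaceT => t.
by apply: cvgD; [exact: cvg_cst|apply: cvgZl; exact: cvg_id].
Qed.

(** Stands in for a subdivision into finitely many small intervals: the points [x] with [G a x] form
    a relatively clopen subset of [a, b] containing [a]. *)
Lemma cousin (R : realType) (G : R -> R -> Prop) (a b : R) :
  a <= b ->
  (forall s t u, s <= t -> t <= u -> G s t -> G t u -> G s u) ->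
  (forall s t u, s <= t -> t <= u -> G s u -> G s t) ->
  (forall x, a <= x <= b -> exists2 e, 0 < e &
     forall s t, x - e < s -> s <= x -> x <= t -> t < x + e -> G s t) ->
  G a b.
Proof.
move=> ab glueG subG locG.
have [ea ea0 Ga] : exists2 e, 0 < e &
    forall s t, a - e < s -> s <= a -> a <= t -> t < a + e -> G s t.
  by apply: locG; rewrite lexx ab.
apply: (@connected_near R `[a, b] (G a) a) => //=.
- exact: segment_connected.
- move=> x; rewrite in_itv /= => axb; have [e e0 Ge] := locG _ axb.
  apply/nbhs_ballP; exists e => //= z.
  rewrite /ball /= in_itv /= => xz /andP[az zb]; move: axb => /andP[ax xb].
  move: xz; rewrite ltr_norml => /andP[xz1 xz2].
  have [zx|xz] := leP z x.
    split=> [|Gaz]; first exact: subG.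
    by apply: (glueG _ z) => //; apply: Ge => //; lra.
  split=> [Gax|]; last by apply: subG => //; exact: ltW.
  by apply: (glueG _ x) => //; [exact: ltW|apply: Ge => //; lra].
- by rewrite in_itv /= lexx ab.
- by apply: Ga; rewrite ?lexx //; lra.
- by rewrite in_itv /= ab lexx.
Qed.

(** * Local systems on a poset and their sections over a space *)

(* [Fib F] is the fibre over [F], and [S e f] says that the elements [e] and [f]
   of the fibres over two comparable faces correspond under transport. *)
Record local_system (P E : Type) (le : P -> P -> Prop) (Fib : P -> set E)
    (S : E -> E -> Prop) : Prop := LocalSystem {
  ls_refl : forall F e, Fib F e -> S e e ;
  ls_sym : forall e f, S e f -> S f e ;
  ls_lift : forall F G e, le F G \/ le G F -> Fib F e ->
    exists2 f, Fib G f & S e f ;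
  ls_uniq : forall F G e f g, le F G \/ le G F ->
    Fib F e -> Fib G f -> Fib G g -> S e f -> S e g -> f = g ;
  ls_trans : forall F G K e f g, le F G -> le G K -> le F K ->
    Fib F e -> Fib G f -> Fib K g -> S e f -> S e g -> S f g }.

Section Sections.
Variables (P E : Type) (le : P -> P -> Prop) (Fib : P -> set E)
  (S : E -> E -> Prop).
Hypothesis sysP : local_system le Fib S.

Definition ls_section (Y : topologicalType) (c : Y -> P) (A : set Y)
    (s : Y -> E) : Prop :=
  forall y, A y -> Fib (c y) (s y) /\ \forall z \near y, A z -> S (s y) (s z).

(** The value at a point can be prescribed: this expresses the absence of monodromy, and it is the
    form that survives gluing. *)
Definition has_sections (Y : topologicalType) (c : Y -> P) (A : set Y) : Prop :=
  forall y e, A y -> Fib (c y) e -> exists2 s, ls_section c A s & s y = e.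

Definition lower_semicontinuous (Y : topologicalType) (c : Y -> P)
    (X : set Y) : Prop :=
  forall y, X y -> \forall z \near y, X z -> le (c y) (c z).

Section OneSpace.
Variables (Y : topologicalType) (c : Y -> P).

Lemma sub_section A B s : A `<=` B -> ls_section c B s -> ls_section c A s.
Proof.
move=> AB Bs y /AB By; have [? h] := Bs y By; split=> //.
by apply: filterS h => z h /AB.
Qed.

Lemma sub_has_sections A B : A `<=` B -> has_sections c B -> has_sections c A.
Proof.
move=> AB gB y e /AB By /(gB _ _ By)[s Bs sy]; exists s => //.
exact: sub_section Bs.
Qed.

Lemma lsc_sub A B : A `<=` B -> lower_semicontinuous c B ->
  lower_semicontinuous c A.
Proof. by move=> AB cB y /AB /cB; apply: filterS => z h /AB. Qed.

(** Agreement of two sections is locally constant: near [y] the face [c z] lies above [c y], and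
    transport between the two fibres is unique in both directions. *)
Lemma section_unique A s t y : lower_semicontinuous c A -> connected A ->
  ls_section c A s -> ls_section c A t -> A y -> s y = t y ->
  forall z, A z -> s z = t z.
Proof.
move=> cA coA As At Ay st; apply: (connected_near (y0 := y) coA) => // x Ax.
have [Fs ns] := As x Ax; have [Ft nt] := At x Ax; have nc := cA x Ax.
apply: filterS3 ns nt nc => z ns nt nc Az.
have [Fs' _] := As z Az; have [Ft' _] := At z Az.
have {ns}ns := ns Az; have {nt}nt := nt Az; have {nc}nc := nc Az.
split=> eqst.
  by apply: (ls_uniq sysP (or_introl nc) Fs Fs' Ft') => //; rewrite eqst.
apply: (ls_uniq sysP (or_intror nc) Fs' Fs Ft); apply: (ls_sym sysP) => //.
by rewrite eqst.
Qed.

(** Transport from the single fibre over [c x] defines the section, and [ls_trans] makes its nearby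
    values compatible. *)
Lemma has_sections_star X x : (forall F G K, le F G -> le G K -> le F K) ->
  lower_semicontinuous c X ->
  has_sections c [set z | X z /\ le (c x) (c z)].
Proof.
move=> tr cX y e [Xy xy] Fe.
have [f Ff ef] := ls_lift sysP (or_intror xy) Fe.
(* Off the star the value is the arbitrary default [e]. *)
pose s z := if pselect (le (c x) (c z)) is left h
            then s2val (cid2 (ls_lift sysP (or_introl h) Ff)) else e.
have sP z : le (c x) (c z) -> Fib (c z) (s z) /\ S f (s z).
  by rewrite /s; case: pselect => // h _; case: cid2.
exists s => [z [Xz xz]|].
  have [Fz fz] := sP z xz; split=> //.
  apply: filterS (cX z Xz) => w cw [Xw xw]; have [Fw fw] := sP w xw.
  exact: (ls_trans sysP xz (cw Xw) xw Ff Fz Fw).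
have [Fy fy] := sP y xy.
by apply: (ls_uniq sysP (or_introl xy) Ff) => //; exact: (ls_sym sysP).
Qed.

(* The locality condition holds both when A and B are relatively open and when
   they are relatively closed in their union. *)
Lemma has_sections_glue A B :
  lower_semicontinuous c (A `|` B) -> connected (A `&` B) -> A `&` B !=set0 ->
  (forall y, (A `|` B) y -> \forall z \near y, (A `|` B) z ->
     (A y /\ A z) \/ (B y /\ B z)) ->
  has_sections c A -> has_sections c B -> has_sections c (A `|` B).
Proof.
move=> cAB coAB [p [Ap Bp]] locAB gA gB.
have glue s t : ls_section c A s -> ls_section c B t -> s p = t p ->
    ls_section c (A `|` B) (fun z => if pselect (A z) then s z else t z) /\
    (forall z, B z -> (if pselect (A z) then s z else t z) = t z).
  move=> As Bt stp.
  have eqst z : A z -> B z -> s z = t z.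
    move=> Az Bz; apply: (@section_unique (A `&` B) s t p) => //.
    - by apply: lsc_sub cAB => ? [? _]; left.
    - by apply: sub_section As => ? [].
    - by apply: sub_section Bt => ? [].
  have eqt z : B z -> (if pselect (A z) then s z else t z) = t z.
    by move=> Bz; case: pselect => // Az; exact: eqst.
  have eqs z : A z -> (if pselect (A z) then s z else t z) = s z.
    by case: pselect.
  split=> // y ABy; split.
    case: ABy => [Ay|By]; first by rewrite (eqs _ Ay); case: (As y).
    by rewrite (eqt _ By); case: (Bt y).
  have ns : \forall z \near y, A y -> A z -> S (s y) (s z).
    have [Ay|nAy] := pselect (A y); last by apply: filterE => z /nAy.
    by apply: filterS (proj2 (As y Ay)) => z h _.
  have nt : \forall z \near y, B y -> B z -> S (t y) (t z).
    have [By|nBy] := pselect (B y); last by apply: filterE => z /nBy.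
    by apply: filterS (proj2 (Bt y By)) => z h _.
  apply: filterS3 (locAB y ABy) ns nt => z lz ns nt ABz.
  case: (lz ABz) => -[hy hz]; first by rewrite !eqs //; exact: ns.
  by rewrite !eqt //; exact: nt.
(* The prescribed value is continued over the piece containing [y], read off at the common point
   [p], and continued from there over the other piece. *)
move=> y e [Ay|By] Fe.
  have [s As sy] := gA y e Ay Fe.
  have [t Bt ty] := gB p (s p) Bp (proj1 (As p Ap)).
  have [ABst _] := glue s t As Bt (esym ty).
  by exists (fun z => if pselect (A z) then s z else t z) => //; case: pselect.
have [t Bt ty] := gB y e By Fe.
have [s As sy] := gA p (t p) Ap (proj1 (Bt p Bp)).
have [ABst eqt] := glue s t As Bt sy.
by exists (fun z => if pselect (A z) then s z else t z) => //; rewrite eqt.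
Qed.

(** The two closed halves meet in the level set. A point off the level set has a neighbourhood on
    one side of it, and a point on it lies in both halves, so the locality condition of gluing
    holds. *)
Lemma has_sections_cut (R : realType) (phi : Y -> R) (t : R) A :
  continuous phi -> lower_semicontinuous c A ->
  connected (A `&` [set y | phi y = t]) -> A `&` [set y | phi y = t] !=set0 ->
  has_sections c (A `&` [set y | phi y <= t]) -> has_sections c (A `&` [set y | t <= phi y]) ->
  has_sections c A.
Proof.
move=> cphi cA.
have -> : A `&` [set y | phi y = t] =
    (A `&` [set y | phi y <= t]) `&` (A `&` [set y | t <= phi y]).
  apply/seteqP; split=> y /=; first by move=> [? ->]; rewrite lexx.
  by move=> [[? le1] [_ le2]]; split=> //; apply/eqP; rewrite eq_le le1.
have eA : A = (A `&` [set y | phi y <= t]) `|` (A `&` [set y | t <= phi y]).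
  apply/seteqP; split=> y /=; last by case=> -[].
  by move=> Ay; case: (leP (phi y) t) => [|/ltW]; [left|right].
move=> co ne g1 g2; rewrite eA; apply: has_sections_glue => //; first by rewrite -eA.
rewrite -eA => y Ay /=; case: (ltgtP (phi y) t) => [lt|gt|eq].
- have : \forall z \near y, phi z < t by exact: (cphi y _ (lt_nbhsl lt)).
  by apply: filterS => z lz Az; left; do !split=> //; exact: ltW.
- have : \forall z \near y, t < phi z by exact: (cphi y _ (lt_nbhsr gt)).
  by apply: filterS => z lz Az; right; do !split=> //; exact: ltW.
- apply: filterE => z Az.
  by case: (leP (phi z) t) => [|/ltW] ?; [left|right]; do !split.
Qed.

End OneSpace.

(** Sections for the pullback along [h] are composed with its right inverse [g]; charts transport
    the result for the plane in this way. *)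
Lemma has_sections_retract (Y Z : topologicalType) (c : Z -> P) (h : Y -> Z)
    (g : Z -> Y) (A : set Z) :
  has_sections (c \o h) setT -> (forall x, A x -> h (g x) = x) ->
  (forall x, A x -> g @ x --> g x) -> has_sections c A.
Proof.
move=> gY hg cg x e Ax Fe.
have [|s Ys sx] := gY (g x) e I; first by rewrite /= hg.
exists (s \o g) => //= y Ay; have [Fy ny] := Ys (g y) I; split.
  by rewrite -{1}(hg y Ay).
have := cg y Ay _ ny; rewrite /nbhs /=.
by apply: filterS => z h' _; exact: h'.
Qed.

(** * The plane *)

Section Plane.
Variables (R : realType) (c : R * R -> P).
Hypothesis le_trans : forall F G K, le F G -> le G K -> le F K.
Hypothesis lsc_c : lower_semicontinuous c setT.

Definition box (a b u v : R) : set (R * R) :=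
  [set p | (a <= p.1 <= b) && (u <= p.2 <= v)].

Lemma box_connected a b u v : connected (box a b u v).
Proof.
have [[p pbox]|] := pselect (exists p, box a b u v p); last first.
  move=> nbox; suff -> : box a b u v = set0 by exact: connected0.
  by apply/seteqP; split=> // p pbox; apply: nbox; exists p.
apply: (@starshaped_connected R (R * R)%type _ p) => // q t.
move: p q pbox => [p1 p2] [q1 q2]; rewrite /box /=.
move=> /andP[/andP[? ?] /andP[? ?]] /andP[/andP[? ?] /andP[? ?]] /andP[? ?].
by apply/andP; split; apply/andP; split; rewrite /GRing.scale /=; nra.
Qed.

Lemma lsc_box a b u v : lower_semicontinuous c (box a b u v).
Proof. exact: lsc_sub lsc_c. Qed.

(** Cousin's argument in the second coordinate. Gluing along a horizontal segment keeps only the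
    smaller of two widths, whence a thin strip around [x]. *)
Lemma has_sections_strip x u v : u <= v ->
  exists2 e, 0 < e & has_sections c (box (x - e) (x + e) u v).
Proof.
move=> uv.
pose G s t := exists2 e, 0 < e & has_sections c (box (x - e) (x + e) s t).
apply: (@cousin R G u v uv) => [s t w st tw [e e0 ge] [f f0 gf]|s t w st tw [e e0 ge]|y _].
- exists (Num.min e f); first by rewrite lt_min e0.
  set m := Num.min e f.
  have me : m <= e by rewrite ge_min lexx.
  have mf : m <= f by rewrite ge_min lexx orbT.
  have m0 : 0 < m by rewrite lt_min e0.
  apply: (@has_sections_cut _ c R (fun p => p.2) t).
  + by move=> p; exact: cvg_snd.
  + exact: lsc_box.
  + rewrite (_ : _ `&` _ = box (x - m) (x + m) t t); first exact: box_connected.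
    apply/seteqP; split=> -[p1 p2]; rewrite /box /=.
      by move=> [/andP[-> _] ->]; rewrite lexx.
    move=> /andP[-> /andP[? ?]]; split; last lra.
    by apply/andP; split; lra.
  + exists (x, t); rewrite /box /=; split=> //.
    by apply/andP; split; apply/andP; split; lra.
  + apply: sub_has_sections ge => -[p1 p2]; rewrite /box /=.
    move=> [/andP[/andP[? ?] /andP[? ?]] ?].
    by apply/andP; split; apply/andP; split; lra.
  + apply: sub_has_sections gf => -[p1 p2]; rewrite /box /=.
    move=> [/andP[/andP[? ?] /andP[? ?]] ?].
    by apply/andP; split; apply/andP; split; lra.
- exists e => //; apply: sub_has_sections ge => -[p1 p2]; rewrite /box /=.
  by move=> /andP[-> /andP[-> ?]] /=; lra.
(* By lower semicontinuity a small square around the point lies in its star. *)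
- have /nbhs_ballP[e /= e0 be] := lsc_c (y := (x, y)) I.
  exists (e / 2); first by lra.
  move=> s t ys sy yt ty; exists (e / 2); first by lra.
  apply: sub_has_sections (has_sections_star (x := (x, y)) le_trans lsc_c) => -[p1 p2].
  rewrite /box /= => /andP[/andP[? ?] /andP[? ?]]; split=> //.
  apply: be => //; split; rewrite /ball /= ltr_norml; apply/andP; split; lra.
Qed.

(** Cousin's argument in the first coordinate, with thin strips as local input and gluing along
    vertical segments. *)
Lemma has_sections_box a b u v : a <= b -> u <= v -> has_sections c (box a b u v).
Proof.
move=> ab uv.
apply: (@cousin R (fun s t => has_sections c (box s t u v)) a b ab)
  => [s t w st tw gs gt|s t w st tw gs|x _].
- apply: (@has_sections_cut _ c R (fun p => p.1) t).
  + by move=> p; exact: cvg_fst.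
  + exact: lsc_box.
  + rewrite (_ : _ `&` _ = box t t u v); first exact: box_connected.
    apply/seteqP; split=> -[p1 p2]; rewrite /box /=.
      by move=> [/andP[_ ->] ->]; rewrite lexx.
    move=> /andP[/andP[? ?] ->]; split; last lra.
    by rewrite andbT; apply/andP; split; lra.
  + exists (t, u); rewrite /box /=; split=> //.
    by apply/andP; split; apply/andP; split; lra.
  + apply: sub_has_sections gs => -[p1 p2]; rewrite /box /=.
    move=> [/andP[/andP[? ?] ->] ?].
    by rewrite andbT; apply/andP; split; lra.
  + apply: sub_has_sections gt => -[p1 p2]; rewrite /box /=.
    move=> [/andP[/andP[? ?] ->] ?].
    by rewrite andbT; apply/andP; split; lra.
- apply: sub_has_sections gs => -[p1 p2]; rewrite /box /=.
  by move=> /andP[/andP[-> ?] ->] /=; lra.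
- have [e e0 ge] := has_sections_strip x uv; exists e => // s t ? ? ? ?.
  apply: sub_has_sections ge => -[p1 p2]; rewrite /box /=.
  by move=> /andP[/andP[? ?] ->] /=; rewrite andbT; apply/andP; split; lra.
Qed.

(** Exhaustion by squares centred at [y]: the sections through [e] on nested squares agree by
    uniqueness and so fit together. *)
Lemma has_sections_plane : has_sections c setT.
Proof.
move=> y e _ Fe.
pose B (n : nat) := box (y.1 - n%:R) (y.1 + n%:R) (y.2 - n%:R) (y.2 + n%:R).
have By n : B n y.
  have n0 : 0 <= n%:R :> R by exact: ler0n.
  by rewrite /B /box /=; apply/andP; split; apply/andP; split; lra.
have exB n : exists s, ls_section c (B n) s /\ s y = e.
  have n0 : 0 <= n%:R :> R by exact: ler0n.
  have [||s Bs sy] := @has_sections_box (y.1 - n%:R) (y.1 + n%:R) (y.2 - n%:R)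
    (y.2 + n%:R) _ _ y e (By n) Fe; [lra|lra|by exists s].
have [s sP] := choice exB.
have Bmono m n : (m <= n)%N -> B m `<=` B n.
  rewrite -(ler_nat R) => mn [p1 p2]; rewrite /B /box /=.
  move=> /andP[/andP[? ?] /andP[? ?]].
  by apply/andP; split; apply/andP; split; lra.
have eqs m n z : (m <= n)%N -> B m z -> s m z = s n z.
  move=> mn; have [sm smy] := sP m; have [sn sny] := sP n.
  apply: (@section_unique _ c (B m) (s m) (s n) y) => //.
  - exact: lsc_box.
  - exact: box_connected.
  - by apply: sub_section sn; exact: Bmono.
  - by rewrite smy.
(* The square has to be a neighbourhood of [z], since a section over it controls only the nearby
   points inside it. *)
have exN (z : R * R) : exists n, \forall w \near z, B n w.
  have [n nP] : exists n, `|z.1 - y.1| + `|z.2 - y.2| + 1 < n%:R.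
    by eexists; exact: truncnS_gt.
  exists n; apply/nbhs_ballP; exists 1 => //= -[w1 w2] /=.
  case: z nP => z1 z2 /= nP [/=]; rewrite /ball /= !ltr_norml.
  have [? ?] := (ler_norm (z1 - y.1), lerNnormlW (lexx `|z1 - y.1|)).
  have [? ?] := (ler_norm (z2 - y.2), lerNnormlW (lexx `|z2 - y.2|)).
  move=> /andP[? ?] /andP[? ?].
  by rewrite /B /box /=; apply/andP; split; apply/andP; split; lra.
have [N NP] := choice exN.
have BN z : B (N z) z by exact: nbhs_singleton (NP z).
have sE n (z : R * R) : B n z -> s (N z) z = s n z.
  move=> Bz; case: (leqP n (N z)) => [|/ltnW] le'; last exact: eqs.
  by apply/esym/eqs.
exists (fun z => s (N z) z); last by rewrite (sE 0%N) //; case: (sP 0%N).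
move=> z _; have [sz _] := sP (N z); have [Fz nz] := sz z (BN z); split=> //.
apply: filterS2 nz (NP z) => w nz Bw _.
by rewrite (sE (N z) w Bw); exact: nz.
Qed.

End Plane.
End Sections.

(** * Sections over the Euclidean plane and the sphere *)

Lemma lsc_comp (P : Type) (le : P -> P -> Prop) (Y Z : topologicalType)
    (c : Z -> P) (h : Y -> Z) (X : set Z) :
  lower_semicontinuous le c X -> continuous h -> (forall y, X (h y)) ->
  lower_semicontinuous le (c \o h) setT.
Proof.
move=> cX ch hX y _; have := ch y _ (cX _ (hX y)); rewrite /nbhs /=.
by apply: filterS => z h' _; exact/h'/hX.
Qed.

Lemma continuous_row (R : realType) (Y : topologicalType) (n : nat)
    (f : 'I_n -> Y -> R) :
  (forall j, continuous (f j)) -> continuous (fun y => \row_j f j y).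
Proof.
move=> cf y; apply/cvg_ballP => e e0.
have : \forall z \near y, forall j : 'I_n, ball (f j y) e (f j z).
  by apply: filter_forall => j; have /cvg_ballP := cf j y; exact.
apply: filterS => z h; split=> // i j; rewrite !mxE; exact: h.
Qed.

Section SimplyConnectedSurfaces.
Variables (P E : Type) (le : P -> P -> Prop) (Fib : P -> set E)
  (S : E -> E -> Prop).
Hypothesis sysP : local_system le Fib S.
Hypothesis le_trans : forall F G K, le F G -> le G K -> le F K.
Variable R : realType.

Lemma has_sections_euclidean_plane (c : 'rV[R]_2 -> P) :
  lower_semicontinuous le c (euclidean_plane R) ->
  has_sections Fib S c (euclidean_plane R).
Proof.
move=> cX.
pose h (p : R * R) : 'rV[R]_2 := \row_j (if j == 0 then p.1 else p.2).
pose g (x : 'rV[R]_2) : R * R := (x 0 0, x 0 1).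
apply: (@has_sections_retract _ _ _ _ (R * R)%type _ c h g).
- apply: (has_sections_plane sysP le_trans); apply: (lsc_comp cX) => //.
  apply: continuous_row => j; case: (j == 0) => p; [exact: cvg_fst|exact: cvg_snd].
- move=> x _; apply/rowP => j; rewrite mxE /=; case: eqP => [->//|].
  case: j => -[|[|//]] j2 jn; first by case: jn; exact: val_inj.
  by congr (x 0 _); exact: val_inj.
- move=> x _.
  exact: (cvg_pair (@coord_continuous _ _ _ 0 0 x) (@coord_continuous _ _ _ 0 1 x)).
Qed.

(* Stereographic projection from the pole (0, 0, s), s = 1 or -1, and its
   inverse. *)
Definition stereo (s : R) (x : 'rV[R]_3) : R * R :=
  (x 0 0 / (1 - s * x 0 (inord 2)), x 0 1 / (1 - s * x 0 (inord 2))).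

Definition stereo_coord (s : R) (j : 'I_3) (p : R * R) : R :=
  (if j == 0 then 2 * p.1 else if j == 1 then 2 * p.2
   else s * (p.1 * p.1 + p.2 * p.2 - 1)) / (p.1 * p.1 + p.2 * p.2 + 1).

Definition stereo_inv (s : R) (p : R * R) : 'rV[R]_3 :=
  \row_j stereo_coord s j p.

(** For s = 1 or -1 this is the sphere without the pole (0, 0, s), as s z = 1 exactly when z = s. *)
Definition punctured_sphere (s : R) : set 'rV[R]_3 :=
  [set x | unit_sphere R x /\ s * x 0 (inord 2) != 1].

Lemma unit_sphereE (x : 'rV[R]_3) : unit_sphere R x =
  (x 0 0 * x 0 0 + x 0 1 * x 0 1 + x 0 (inord 2) * x 0 (inord 2) = 1).
Proof.
rewrite /unit_sphere /= !big_ord_recl big_ord0 addr0 !expr2 addrA.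
have -> : inord 2 = lift ord0 (lift ord0 ord0) :> 'I_3.
  by apply: val_inj; rewrite /= inordK.
by have -> : (1 : 'I_3) = lift ord0 ord0 by exact: val_inj.
Qed.

Lemma stereo_inv0 s p : stereo_inv s p 0 0 = 2 * p.1 / (p.1 * p.1 + p.2 * p.2 + 1).
Proof. by rewrite mxE. Qed.
Lemma stereo_inv1 s p : stereo_inv s p 0 1 = 2 * p.2 / (p.1 * p.1 + p.2 * p.2 + 1).
Proof. by rewrite mxE. Qed.
Lemma stereo_inv2 s p : stereo_inv s p 0 (inord 2) =
  s * (p.1 * p.1 + p.2 * p.2 - 1) / (p.1 * p.1 + p.2 * p.2 + 1).
Proof. by rewrite mxE /stereo_coord -!val_eqE /= !inordK. Qed.

Lemma stereo_denom_gt0 (p : R * R) : 0 < p.1 * p.1 + p.2 * p.2 + 1.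
Proof. by nra. Qed.

Lemma stereo_inv_sphere s p : s * s = 1 -> punctured_sphere s (stereo_inv s p).
Proof.
move=> ss; have d0 := stereo_denom_gt0 p; split.
  rewrite unit_sphereE stereo_inv0 stereo_inv1 stereo_inv2.
  set a := p.1 in d0 *; set b := p.2 in d0 *.
  have dn : a * a + b * b + 1 != 0 by rewrite gt_eqF.
  have -> : s * (a * a + b * b - 1) / (a * a + b * b + 1) *
      (s * (a * a + b * b - 1) / (a * a + b * b + 1)) =
      (s * s) * ((a * a + b * b - 1) / (a * a + b * b + 1)) ^+ 2.
    by field.
  by rewrite ss; field.
rewrite stereo_inv2 2!mulrA ss mul1r; apply/eqP => h.
have := congr1 (fun x => x * (p.1 * p.1 + p.2 * p.2 + 1)) h.
by rewrite mulfVK ?gt_eqF // mul1r; lra.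
Qed.

Lemma stereoK s x : s * s = 1 -> punctured_sphere s x ->
  stereo_inv s (stereo s x) = x.
Proof.
move=> ss [+ /eqP nz]; rewrite unit_sphereE => sx.
have X0 := stereo_inv0 s (stereo s x).
have X1 := stereo_inv1 s (stereo s x).
have X2 := stereo_inv2 s (stereo s x).
move: X0 X1 X2; rewrite /stereo /=.
move: sx nz.
set a := x 0 0; set b := x 0 1; set z := x 0 (inord 2) => sx nz.
have dn : 1 - s * z != 0 by apply/eqP; lra.
(* On the sphere a^2 + b^2 = 1 - z^2 = (1 - s z)(1 + s z), which gives the squared norm of the
   projected point. *)
have -> : a / (1 - s * z) * (a / (1 - s * z)) + b / (1 - s * z) * (b / (1 - s * z)) =
   (1 + s * z) / (1 - s * z).
  have -> : a / (1 - s * z) * (a / (1 - s * z)) + b / (1 - s * z) * (b / (1 - s * z)) =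
    (a * a + b * b) / (1 - s * z) ^+ 2 by field.
  have -> : a * a + b * b = (1 - s * z) * (1 + s * z).
    have -> : (1 - s * z) * (1 + s * z) = 1 - (s * s) * (z * z) by ring.
    by rewrite ss; lra.
  by field.
have -> : (1 + s * z) / (1 - s * z) + 1 = 2 / (1 - s * z) by field.
have -> : (1 + s * z) / (1 - s * z) - 1 = 2 * (s * z) / (1 - s * z) by field.
have -> : 2 * (a / (1 - s * z)) / (2 / (1 - s * z)) = a by field.
have -> : 2 * (b / (1 - s * z)) / (2 / (1 - s * z)) = b by field.
have -> : s * (2 * (s * z) / (1 - s * z)) / (2 / (1 - s * z)) = (s * s) * z by field.
rewrite ss mul1r => X0 X1 X2.
apply/rowP => -[[|[|[|//]]] j3].
- by rewrite (_ : Ordinal _ = 0) //; exact: val_inj.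
- by rewrite (_ : Ordinal _ = 1) //; exact: val_inj.
- by rewrite (_ : Ordinal _ = inord 2) //; apply: val_inj; rewrite /= inordK.
Qed.

Lemma stereo_inv_continuous s : continuous (stereo_inv s).
Proof.
apply: continuous_row => j p; rewrite /stereo_coord.
have c1 : (fun q : R * R => q.1) @ p --> p.1 by exact: cvg_fst.
have c2 : (fun q : R * R => q.2) @ p --> p.2 by exact: cvg_snd.
have cn : (fun q : R * R => q.1 * q.1 + q.2 * q.2) @ p -->
    p.1 * p.1 + p.2 * p.2.
  by apply: cvgD; apply: cvgM.
apply: cvgM; last first.
  apply: cvgV; first by rewrite gt_eqF // stereo_denom_gt0.
  by apply: cvgD => //; exact: cvg_cst.
case: (j == 0); first by apply: cvgM => //; exact: cvg_cst.
case: (j == 1); first by apply: cvgM => //; exact: cvg_cst.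
apply: cvgM; first exact: cvg_cst.
by apply: cvgB => //; exact: cvg_cst.
Qed.

Lemma stereo_continuous s (x : 'rV[R]_3) : s * x 0 (inord 2) != 1 ->
  stereo s @ x --> stereo s x.
Proof.
move=> nz; have Fx : Filter (nbhs x) := nbhs_filter x.
have cd : (fun y : 'rV[R]_3 => (1 - s * y 0 (inord 2))^-1) @ x -->
    (1 - s * x 0 (inord 2))^-1.
  have dn : 1 - s * x 0 (inord 2) != 0 by rewrite subr_eq0 eq_sym.
  apply: cvgV => //; apply: cvgB; first exact: cvg_cst.
  by apply: cvgM; [exact: cvg_cst|exact: coord_continuous].
by apply: (cvg_pair (cvgM (@coord_continuous _ _ _ 0 0 x) cd)
  (cvgM (@coord_continuous _ _ _ 0 1 x) cd)).
Qed.

(** Union of the two planes slit along a closed horizontal half-line from the origin; each is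
    star-shaped about (1, 0) or (-1, 0), and both contain (0, 1). *)
Lemma punctured_plane_connected : connected ([set~ (0, 0)] : set (R * R)).
Proof.
pose A (s : R) : set (R * R) := [set p | 0 < s * p.1 \/ p.2 != 0].
have coA s : s * s = 1 -> connected (A s).
  move=> ss; apply: (@starshaped_connected R (R * R)%type _ (s, 0)).
    by left; rewrite /= ss.
  move=> [p1 p2] t; rewrite /A /= => Ap /andP[t0 t1].
  have [->|tn] := eqVneq t 0; first by left; rewrite /= scale0r addr0 ss.
  have {t0 tn}t0 : 0 < t by rewrite lt_def tn.
  case: Ap => [sp|p20]; [left|right].
    have -> : s * (s + t *: (p1 - s)) = s * s + t * (s * p1 - s * s).
      by rewrite /GRing.scale /=; ring.
    rewrite ss; nra.
  rewrite add0r subr0 /GRing.scale /= mulf_neq0 // gt_eqF //.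
have -> : [set~ (0, 0)] = A 1 `|` A (-1).
  apply/seteqP; split=> -[p1 p2]; rewrite /A /=.
    move=> pn; have [p20|] := eqVneq p2 0; last by left; right.
    have [h|h|h] := ltgtP p1 0.
    - by right; left; lra.
    - by left; left; lra.
    - by exfalso; apply: pn; rewrite h p20.
  by case=> -[] h [p10 p20]; move: h; rewrite ?p10 ?p20 ?mulr0 ?ltxx ?eqxx.
apply: connectedU; [|apply: coA; ring|apply: coA; ring].
by exists (0, 1); split; right; rewrite /= oner_neq0.
Qed.

Lemma has_sections_unit_sphere (c : 'rV[R]_3 -> P) :
  lower_semicontinuous le c (unit_sphere R) -> has_sections Fib S c (unit_sphere R).
Proof.
move=> cX.
have sphereU : unit_sphere R = punctured_sphere 1 `|` punctured_sphere (-1).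
  apply/seteqP; split=> x; last by case=> -[].
  move=> Sx; have [h|h] := eqVneq (1 * x 0 (inord 2)) 1; last by left.
  by right; split=> //; rewrite mulN1r -[x _ _]mul1r h; apply/eqP; lra.
have gA s : s * s = 1 -> has_sections Fib S c (punctured_sphere s).
  move=> ss; apply: (@has_sections_retract _ _ _ _ (R * R)%type _ c (stereo_inv s)
    (stereo s)).
  - apply: (has_sections_plane sysP le_trans); apply: (lsc_comp cX).
      exact: stereo_inv_continuous.
    by move=> p; case: (stereo_inv_sphere p ss).
  - by move=> x; exact: stereoK.
  - by move=> x [_]; exact: stereo_continuous.
have ss1 : 1 * 1 = 1 :> R by rewrite mulr1.
have ssN : -1 * -1 = 1 :> R by rewrite mulrNN mulr1.
rewrite sphereU; apply: (has_sections_glue sysP); [by rewrite -sphereU| | | |exact: gA|exact: gA].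
(* [stereo_inv 1] sends the origin to (0, 0, -1), the point missing from the other chart. *)
- rewrite (_ : _ `&` _ = stereo_inv 1 @` [set~ (0, 0)]).
    apply: connected_continuous_connected; first exact: punctured_plane_connected.
    by apply: continuous_subspaceT; exact: stereo_inv_continuous.
  apply/seteqP; split=> [x [Ax [Sx Bx]]|_ [p /= pn <-]].
    exists (stereo 1 x); last exact: stereoK.
    move=> /= st0; move/eqP: Bx; apply.
    by rewrite -(stereoK ss1 Ax) stereo_inv2 st0 /=; field.
  have [Sp Ap] := stereo_inv_sphere p ss1; do !split=> //.
  rewrite stereo_inv2; have d0 := stereo_denom_gt0 p; apply/eqP => h.
  have := congr1 (fun x => x * (p.1 * p.1 + p.2 * p.2 + 1)) h.
  rewrite mulrA mulfVK ?gt_eqF // => h'.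
  apply: pn; case: p h' {h d0 Sp Ap} => a b /= h'.
  by congr (_, _); nra.
- exists (stereo_inv 1 (1, 0)); have [Sp Ap] := stereo_inv_sphere (1, 0) ss1.
  by do !split=> //; rewrite stereo_inv2 /=; apply/eqP; lra.
(* Each chart is relatively open in the sphere, which yields the locality condition of gluing. *)
- have near_neq s (x : 'rV[R]_3) : s * x 0 (inord 2) != 1 ->
      nbhs x [set z : 'rV[R]_3 | s * z 0 (inord 2) != 1].
    move=> nz.
    have cs : (fun y : 'rV[R]_3 => s * y 0 (inord 2)) @ x --> s * x 0 (inord 2).
      have Fx : Filter (nbhs x) := nbhs_filter x.
      by apply: cvgM; [exact: cvg_cst|exact: coord_continuous].
    have oU : open [set r : R | r != 1].
      rewrite (_ : [set _ | _] = ~` [set 1]).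
        by rewrite openC; exact: (@closed_eq R 1).
      by apply/seteqP; split=> r /= /eqP.
    by have := cs _ (open_nbhs_nbhs (conj oU nz)).
  rewrite -sphereU => x Sx.
  have : (punctured_sphere 1 `|` punctured_sphere (-1)) x by rewrite -sphereU.
  move=> -[[_ nz]|[_ nz]].
    by apply: filterS (near_neq _ _ nz) => z nz' Sz; left; split; split.
  by apply: filterS (near_neq _ _ nz) => z nz' Sz; right; split; split.
Qed.

End SimplyConnectedSurfaces.

(** * From sections over the surface to families on the faces *)

Section CellFamily.
Variables (R : realType) (d : Order.disp_t) (Q : porderType d) (rk : Q -> int)
  (T : topologicalType) (X : set T).
Let P := {F : Q | proper_face rk F}.
Let le (F G : P) : Prop := (sval F <= sval G)%O.
Variables (E : Type) (Fib : P -> set E) (S : E -> E -> Prop).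
Hypothesis sysP : local_system le Fib S.
Hypothesis mapX : map_on R rk X.
Hypothesis sectionsX : forall c : T -> P, lower_semicontinuous le c X ->
  has_sections Fib S c X.

Lemma rV_connected (i : nat) : connected [set: 'rV[R]_i].
Proof. by apply: (@starshaped_connected R _ _ 0). Qed.

(** A section for the map sending a point to the face of its cell is constant on each connected
    cell, and this constant is the value of the family. Comparable faces match because the smaller
    cell lies in the closure of the larger. *)
Lemma global_family (F0 : P) (e0 : E) : Fib F0 e0 ->
  exists s : P -> E, [/\ (forall F, Fib F (s F)), s F0 = e0 &
    forall F G, le F G -> S (s F) (s G)].
Proof.
move=> Fe0; have [cell [homeo Xcell disj clos lfin]] := mapX.
have cellX F : proper_face rk F -> cell F `<=` X.
  by move=> pF x Fx; rewrite Xcell; exists F.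
have cellP (F : P) : connected (cell (sval F)) /\ cell (sval F) !=set0.
  case: F => F /= pF.
  have [f [g [_ cg fg gf]]] := homeo F `|rk F|%N pF (esym (gez0_abs (proj1 (andP pF)))).
  have -> : cell F = g @` setT.
    apply/seteqP; split=> [x Fx|_ [y _ <-]]; last by case: (gf y I).
    by exists (f x) => //; case: (fg x Fx).
  split; last by exists (g 0), 0.
  by apply: connected_continuous_connected => //; exact: rV_connected.
(* [F0] is the default off [X]. *)
pose c (x : T) : P := xget F0 [set F : P | cell (sval F) x].
have cE (F : P) x : cell (sval F) x -> c x = F.
  move=> Fx; have := @xgetPex _ F0 [set F : P | cell (sval F) x] (ex_intro _ F Fx).
  rewrite -/(c x) /= => cx; apply: eq_sig_hprop; first by move=> *; exact: Prop_irrelevance.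
  by apply: disj; [exact: (svalP (c x))|exact: (svalP F)|exists x].
have cX x : X x -> cell (sval (c x)) x.
  rewrite Xcell => -[F pF Fx].
  by rewrite (cE (exist _ F pF) x).
(* Only finitely many cells meet [U]. Those of faces not above [c x] have closures missing [x],
   since a point of [X] in the closure of a cell lies in the cell of a face below; the union of
   these closures is closed. *)
have lc : lower_semicontinuous le c X.
  move=> x Xx; have [U Ux finU] := lfin x Xx.
  pose D := [set F | proper_face rk F /\ cell F `&` U !=set0].
  pose D' := D `&` [set F | ~ (sval (c x) <= F)%O].
  have clD : closed (\bigcup_(F in D') closure (cell F)).
    apply: closed_bigcup => [|F _]; last exact: closed_closure.
    by apply: sub_finite_set finU => F [].
  have nD : \forall z \near x, ~ (\bigcup_(F in D') closure (cell F)) z.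
    apply: open_nbhs_nbhs; split; first by rewrite openC.
    move=> [F [[pF _] nF] clF]; apply: nF.
    have : (closure (cell F) `&` X) x by [].
    rewrite clos // => -[G [pG GF] Gx].
    by rewrite (cE (exist _ G pG) x).
  apply: filterS2 Ux nD => z Uz nD Xz.
  apply: contrapT => ncz; apply: nD; exists (sval (c z)).
    by split=> //; split; [exact: svalP|exists z; split => //; exact: cX].
  exact/subset_closure/cX.
pose pt (F : P) : T := projT1 (cid (cellP F).2).
have ptP F : cell (sval F) (pt F) by rewrite /pt; case: cid.
have Xpt F : X (pt F) by apply: (cellX (sval F)) => //; exact: svalP.
have [|s Xs s0] := sectionsX lc (Xpt F0) (e := e0); first by rewrite (cE F0).
have Fs F : Fib F (s (pt F)) by have [+ _] := Xs _ (Xpt F); rewrite (cE F).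
(* On a cell the section is compared with a constant one. *)
have const (F : P) x : cell (sval F) x -> s x = s (pt F).
  move=> Fx.
  apply: (@section_unique _ _ _ _ _ sysP _ c (cell (sval F)) s (fun=> s (pt F)) (pt F)) => //.
  - by apply: lsc_sub lc; apply: cellX; exact: svalP.
  - by case: (cellP F).
  - by apply: sub_section Xs; apply: cellX; exact: svalP.
  - move=> y Fy; rewrite (cE F) //; split=> //.
    by apply: filterE => z _; exact: (ls_refl sysP (Fs F)).
exists (fun F => s (pt F)); split=> // F G FG.
have [_ nF] := Xs _ (Xpt F).
have : closure (cell (sval G)) (pt F).
  suff [] : (closure (cell (sval G)) `&` X) (pt F) by [].
  rewrite clos; last exact: svalP.
  by exists (sval F) => //; split=> //; exact: svalP.
move=> /(_ _ nF)[y [Gy]]; rewrite -(const G y Gy); apply.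
by apply: (cellX (sval G)) => //; exact: svalP.
Qed.

End CellFamily.

(** * Generated subgroups and dihedral actions *)

Lemma generated_subgroup (G : groupType) (A : set G) : subgroup (generated A).
Proof.
split.
- by move=> H [[H1 _ _] _].
- move=> x y Ax Ay H AH; have [[_ HM _] _] := AH.
  by apply: HM; [exact: Ax|exact: Ay].
- by move=> x Ax H AH; have [[_ _ HV] _] := AH; apply: HV; exact: Ax.
Qed.

Lemma sub_generated (G : groupType) (A : set G) : A `<=` generated A.
Proof. by move=> x Ax H [_]; apply. Qed.

Lemma generated_min (G : groupType) (A H : set G) :
  subgroup H -> A `<=` H -> generated A `<=` H.
Proof. by move=> sH AH x; apply. Qed.

Lemma generated_mono (G : groupType) (A B : set G) :
  A `<=` B -> generated A `<=` generated B.
Proof.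
move=> AB; apply: generated_min; first exact: generated_subgroup.
by move=> x /AB; exact: sub_generated.
Qed.

(** Right multiplication by an involution undoes itself, so induction over words in the generators
    has no case for inverses. *)
Lemma generated_ind (G : groupType) (A D : set G) :
  (forall a, A a -> a * a = 1)%g -> D 1%g ->
  (forall y a, A a -> D y -> D (y * a)%g) -> generated A `<=` D.
Proof.
move=> Ainv D1 DM.
pose H := [set x : G | forall y, D y <-> D (y * x)%g].
have sH : subgroup H.
  split.
  - by move=> y; rewrite mulg1.
  - by move=> x z Hx Hz y; rewrite mulgA; apply: iff_trans (Hx y) (Hz _).
  - by move=> x Hx y; have := Hx (y * x^-1)%g; rewrite mulgVK; apply: iff_sym.
have AH : A `<=` H.
  move=> a Aa y; split; first exact: DM.
  by move=> /(DM _ _ Aa); rewrite -mulgA Ainv // mulg1.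
by move=> x /(generated_min sH AH) /(_ 1%g); rewrite mul1g => -[h _]; exact: h.
Qed.

Section Dihedral.
Variables (G : groupType) (a b : G).
Hypotheses (aa : (a * a = 1)%g) (bb : (b * b = 1)%g).

Lemma expg_swap (x y : G) m : (y * (x * y) ^+ m = (y * x) ^+ m * y)%g.
Proof. by elim: m => [|m IH]; rewrite ?mulg1 ?mul1g // expgSr expgSr mulgA IH !mulgA. Qed.

Lemma expg_invol m : ((b * a) ^+ m = ((a * b) ^+ m)^-1)%g.
Proof.
apply/esym/mulg1_eq; elim: m => [|m IH]; first by rewrite mulg1.
rewrite expgSr expgS !mulgA -(mulgA _ b b) bb mulg1 -(mulgA _ a a) aa mulg1.
exact: IH.
Qed.

(** Right multiplication by [a] or [b] exchanges rotations and reflections. Listing inverses and two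
    shapes of reflection keeps all exponents natural. *)
Lemma dihedral_elements : generated [set a; b] `<=`
  [set k | (exists m, k = ((a * b) ^+ m)%g \/ k = ((a * b) ^+ m)^-1%g) \/
    exists m, k = ((a * b) ^+ m * a)%g \/ k = ((b * a) ^+ m * b)%g].
Proof.
apply: generated_ind => [x [->|->] //||y x ab].
  by left; exists 0%N; left.
have E1 m : ((a * b) ^+ m * a * a = (a * b) ^+ m)%g by rewrite -mulgA aa mulg1.
have E2 m : ((b * a) ^+ m * b * b = (b * a) ^+ m)%g by rewrite -mulgA bb mulg1.
have E3 m : ((a * b) ^+ m * a * b = (a * b) ^+ m.+1)%g by rewrite expgSr mulgA.
have E4 m : ((b * a) ^+ m * b * a = (b * a) ^+ m.+1)%g by rewrite expgSr mulgA.
move=> [[m [->|->]]|[m [->|->]]].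
- case: ab => ->; first by right; exists m; left.
  case: m => [|m]; first by right; exists 0%N; right.
  by right; exists m; left; rewrite expgSr !mulgA -(mulgA _ b b) bb mulg1.
- rewrite -expg_invol; case: ab => ->; last by right; exists m; right.
  case: m => [|m]; first by right; exists 0%N; left.
  by right; exists m; right; rewrite expgSr !mulgA -(mulgA _ a a) aa mulg1.
- left; case: ab => ->; first by exists m; left; rewrite E1.
  by exists m.+1; left; rewrite E3.
- left; case: ab => ->; first by exists m.+1; right; rewrite E4 expg_invol.
  by exists m; right; rewrite E2 expg_invol.
Qed.

End Dihedral.

(** Since (ab)^(m+1) a = a (ba)^m b a, conjugation by [a] leads to a shorter reflection with [a] and
    [b] exchanged, and finally to a generator. *)
Lemma reflection_fixfree (G : groupType) (T : Type) (act : T -> G -> T) (a b : G) :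
  (forall x g h, act x (g * h)%g = act (act x g) h) ->
  (forall x, act x 1%g = x) ->
  (a * a = 1)%g -> (b * b = 1)%g ->
  (forall x, act x a <> x) -> (forall x, act x b <> x) ->
  forall m x, act x ((a * b) ^+ m * a)%g <> x.
Proof.
move=> actM act1 aa bb fa fb m.
elim: m a b aa bb fa fb => [|m IH] a b aa bb fa fb x; first by rewrite mul1g.
rewrite expgS -!mulgA (mulgA b) expg_swap 2!actM => h.
apply: (IH b a bb aa fb fa (act x a)).
by rewrite -[LHS]act1 -aa actM h.
Qed.

Lemma card_le_inj (T U : Type) (A : set T) (B : set U) (f : T -> U) :
  (forall x, A x -> B (f x)) ->
  (forall x y, A x -> A y -> f x = f y -> x = y) -> A #<= B.
Proof.
move=> fAB finj.
have /card_eqPle[_ h] : f @` A #= A.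
  by apply: inj_card_eq => x y /set_mem Ax /set_mem Ay; exact: finj.
by apply: card_le_trans h _; apply: subset_card_le => _ [x Ax <-]; exact: fAB.
Qed.

(** * Rotations acting on the flags through a vertex or a face *)

Section Rotation.
Variables (G : groupType) (T Q : Type) (act : T -> G -> T) (a b : G).
Hypotheses (actM : forall x g h, act x (g * h)%g = act (act x g) h)
  (act1 : forall x, act x 1%g = x)
  (aa : (a * a = 1)%g) (bb : (b * b = 1)%g)
  (fa : forall x, act x a <> x) (fb : forall x, act x b <> x).
Variables (Fl : set T) (Ed : set Q) (eps : T -> Q).
Hypotheses (Fla : forall x, Fl x -> Fl (act x a))
  (Flb : forall x, Fl x -> Fl (act x b))
  (Flt : forall x y, Fl x -> Fl y ->
     exists2 k, generated [set a; b] k & act x k = y)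
  (epsE : forall x, Fl x -> Ed (eps x))
  (epsS : forall e, Ed e -> exists2 x, Fl x & eps x = e)
  (epsb : forall x, Fl x -> eps (act x b) = eps x)
  (epsI : forall x y, Fl x -> Fl y -> eps x = eps y -> y = x \/ y = act x b).

Let t : G := (a * b)%g.

Lemma Fl_rot x m : Fl x -> Fl (act x (t ^+ m)%g).
Proof.
move=> Fx; elim: m => [|m IH]; first by rewrite act1.
by rewrite expgSr actM /t actM; exact/Flb/Fla.
Qed.

Lemma rotation_eps_inj x i j : Fl x -> (i <= j)%N ->
  eps (act x (t ^+ i)%g) = eps (act x (t ^+ j)%g) ->
  act x (t ^+ (j - i))%g = x.
Proof.
move=> Fx ij; have [m ->] : exists m, j = (m + i)%N by exists (j - i)%N; lia.
rewrite addnK expgnDr actM.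
have actI y z g : act y g = act z g -> y = z.
  by move=> h; rewrite -(act1 y) -(mulgV g) actM h -actM mulgV act1.
move=> h; case: (epsI (Fl_rot i Fx) (Fl_rot i (Fl_rot m Fx)) h) => [/actI//|].
have -> : act (act x (t ^+ m)%g) (t ^+ i)%g = act (act x (t ^+ i)%g) (t ^+ m)%g.
  by rewrite -!actM -!expgnDr addnC.
move=> h'; have {}h' : act (act x (t ^+ i)%g) (t ^+ m * b)%g = act x (t ^+ i)%g.
  by rewrite actM h' -actM bb act1.
(* t^0 b is [b], and t^(m+1) b is the reflection (ab)^m a. *)
exfalso; case: m h' {h} => [|m]; first by rewrite mul1g; exact: fb.
rewrite expgSr /t !mulgA -(mulgA _ b b) bb mulg1.
exact: reflection_fixfree.
Qed.

(** With [q] the least period of [x] under [t], the first [q] flags of the orbit meet every edge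
    exactly once, which counts [Ed], and [q] divides [m]. *)
Lemma rotation_period x m : Fl x -> (0 < m)%N -> act x (t ^+ m)%g = x ->
  exists q l, [/\ Ed #= `I_q, m = (q * l)%N & act x (t ^+ q)%g = x].
Proof.
move=> Fx m0 xm.
have ex : exists q, (0 < q)%N && `[< act x (t ^+ q)%g = x >].
  by exists m; rewrite m0; exact/asboolP.
case: (ex_minnP ex) => q /andP[q0 /asboolP xq] qmin.
have xqk k : act x (t ^+ (k * q))%g = x.
  by elim: k => [|k IH]; rewrite ?act1 // mulSn expgnDr actM xq.
have xmod k : act x (t ^+ k)%g = act x (t ^+ (k %% q))%g.
  by rewrite {1}(divn_eq k q) expgnDr actM xqk.
(* Modulo the period an inverse power becomes a natural one, with exponent k (q - 1). *)
have xneg k : act x (t ^+ k)^-1%g = act x (t ^+ (k * q.-1))%g.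
  rewrite -{1}(xqk k) -actM; congr act.
  by rewrite -{1}(prednK q0) mulnS addnC expgnDr mulgK.
have small k : (0 < k < q)%N -> act x (t ^+ k)%g <> x.
  move=> /andP[k0 kq] xk; have := qmin k; rewrite k0 leqNgt kq /=.
  by move=> H; have : false by apply: H; exact/asboolP.
exists q, (m %/ q)%N; split=> //; last first.
  rewrite mulnC; apply/esym/eqP; rewrite -/(dvdn q m) divnK //.
  rewrite /dvdn; case: posnP => // r0; exfalso.
  by apply: (small (m %% q)%N); rewrite ?r0 ?ltn_mod // -xmod.
have -> : Ed = (fun j => eps (act x (t ^+ j)%g)) @` `I_q.
  apply/seteqP; split=> [e|_ [j _ <-]]; last exact/epsE/Fl_rot.
  suff H : Ed e -> exists k, e = eps (act x (t ^+ k)%g).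
    by move=> /H[k ->]; exists (k %% q)%N; rewrite /= ?ltn_mod // -xmod.
  move=> /epsS[y Fy <-]; have [k /(dihedral_elements aa bb) hk <-] := Flt Fx Fy.
  (* A reflection is turned into a rotation by appending or dropping [b], which keeps the edge. *)
  case: hk => -[n [->|->]].
  - by exists n.
  - by exists (n * q.-1)%N; rewrite xneg.
  - exists n.+1; rewrite -epsb -?actM; last by rewrite actM; exact/Fla/Fl_rot.
    by rewrite expgSr /t mulgA.
  - exists (n * q.-1)%N; rewrite -xneg actM epsb expg_invol // -/t xneg.
    exact: Fl_rot.
apply: inj_card_eq => i j /set_mem /= iq /set_mem /= jq.
wlog ij : i j iq jq / (i <= j)%N.
  move=> H; case: (leqP i j) => [|/ltnW] h; first exact: H.
  by move=> /esym /(H _ _ jq iq h).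
move=> /(rotation_eps_inj Fx ij) xji; case: (posnP (j - i)) => [|ji0]; first by lia.
by exfalso; apply: (small (j - i)%N) => //; lia.
Qed.

(** Pigeonhole: among [q.+1] powers of [t] two give the same edge, so the orbit is periodic, and its
    least period is the number of edges. *)
Lemma rotation_card x q : Fl x -> Ed #= `I_q -> act x (t ^+ q)%g = x.
Proof.
move=> Fx Edq.
have [[i [j [ij eij]]]|ninj] := pselect (exists i j, (i < j)%N /\
    eps (act x (t ^+ i)%g) = eps (act x (t ^+ j)%g)); last first.
  have : `I_q.+1 #<= Ed.
    apply: (@card_le_inj _ _ _ _ (fun i => eps (act x (t ^+ i)%g))).
      by move=> i _; exact/epsE/Fl_rot.
    move=> i j _ _ eij; case: (ltngtP i j) => // ij; exfalso; apply: ninj.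
      by exists i, j.
    by exists j, i.
  by rewrite (card_le_eqr Edq) card_le_II ltnn.
have := rotation_eps_inj Fx (ltnW ij) eij.
move=> /(rotation_period Fx _)[|r [l [Edr _ xr]]]; first by rewrite subn_gt0.
have : `I_q #= `I_r by rewrite -(card_eql Edq).
by move=> /card_eq_II ->.
Qed.

End Rotation.

(** * Flags of a polyhedron *)

Lemma card_two (T : Type) (A : set T) x y z :
  A #= `I_2 -> A x -> A y -> A z -> y <> x -> z <> x -> y = z.
Proof.
move=> /card_eqPle[A2 _] Ax Ay Az yx zx; apply: contrapT => yz.
have : `I_3 #<= A.
  apply: (@card_le_inj _ _ _ _ (nth x [:: x; y; z])).
    by move=> [|[|[|]]].
  move=> [|[|[|//]]] [|[|[|//]]] //= _ _ /esym //.
by move=> /card_le_trans /(_ A2); rewrite card_le_II.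
Qed.

Section Flags.
Variables (d : Order.disp_t) (Q : tbPOrderType d) (rk : Q -> int).
Hypothesis polyQ : abstract_polyhedron rk.

Lemma flag_ext (Psi Psi' : flag Q) : sval Psi = sval Psi' -> Psi = Psi'.
Proof. by move=> h; apply: eq_sig_hprop => // *; exact: Prop_irrelevance. Qed.

Lemma flag_le (Psi : flag Q) F G : sval Psi F -> sval Psi G ->
  (F <= G)%O \/ (G <= F)%O.
Proof. by case: Psi => C [chC _] /= CF CG; exact: chC. Qed.

Lemma flag_lt (Psi : flag Q) F G : sval Psi F -> sval Psi G -> rk F < rk G ->
  (F < G)%O.
Proof.
move=> PF PG FG; rewrite lt_neqAle.
have -> /= : F != G by apply/eqP => h; move: FG; rewrite h ltxx.
case: (flag_le PF PG) => //; rewrite le_eqVlt => /orP[/eqP ->//|].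
by move=> /(rank_mono polyQ) /lt_trans /(_ FG); rewrite ltxx.
Qed.

Lemma flag_rank_inj (Psi : flag Q) F G : sval Psi F -> sval Psi G ->
  rk F = rk G -> F = G.
Proof.
move=> PF PG FG; apply/eqP; apply: contrapT => /negP nFG.
by case: (flag_le PF PG); rewrite le_eqVlt ?(negbTE nFG) 1?eq_sym ?(negbTE nFG) /=
  => /(rank_mono polyQ); rewrite FG ltxx.
Qed.

Lemma rank_bounds F : -1 <= rk F /\ rk F <= 3.
Proof. by have /andP[] := rank_range polyQ F. Qed.

(** A flag has five faces, with distinct ranks among -1, ..., 3. *)
Lemma flag_rank_ex (Psi : flag Q) (i : int) : -1 <= i -> i <= 3 ->
  exists2 F, sval Psi F & rk F = i.
Proof.
move=> i1 i3; apply: contrapT => nex.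
have ni F : sval Psi F -> rk F <> i by move=> PF h; apply: nex; exists F.
have : sval Psi #<= `I_4.
  (* Closing the gap at the missing rank [i] numbers the faces by 0, ..., 3. *)
  apply: (@card_le_inj _ _ _ _ (fun F =>
    if rk F < i then absz (rk F + 1) else absz (rk F))).
    by move=> F PF /=; have [? ?] := rank_bounds F; have := ni F PF;
      case: ifP => ?; lia.
  move=> F G PF PG h; apply: (flag_rank_inj PF PG); move: h.
  have [? ?] := rank_bounds F; have [? ?] := rank_bounds G.
  by have := ni F PF; have := ni G PG; do 2!case: ifP => ?; lia.
by rewrite (card_le_eql (flag_card polyQ Psi)) card_le_II.
Qed.

(** Zorn's lemma is applied to the sets [D] whose union with [C] is a chain, so that the empty union
    is admissible too. *)
Lemma flag_extend (C : set Q) : chain C -> exists Psi : flag Q, C `<=` sval Psi.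
Proof.
move=> chC.
have [|A [chA maxA]] := @Zorn_bigcup _ (fun D : set Q => chain (C `|` D)).
  move=> F FP totF x y [Cx|[X FX Xx]] [Cy|[Y FY Yy]].
  - exact: chC.
  - by apply: (FP Y FY); [left|right].
  - by apply: (FP X FX); [right|left].
  - case: (totF X Y FX FY) => XY.
      by apply: (FP Y FY); right => //; exact: XY.
    by apply: (FP X FX); right => //; exact: XY.
suff fl : is_flag (C `|` A) by exists (exist _ _ fl) => x; left.
split=> // D chD CAD; apply/seteqP; split=> // x Dx; apply: contrapT => nx.
apply: (maxA D).
  by split; [move=> y Ay; apply: CAD; right|move=> /(_ x Dx) Ax; apply: nx; right].
by rewrite (_ : C `|` D = D) //; apply/seteqP; split=> y; [case=> // Cy; apply: CAD; left|right].
Qed.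

Lemma flag_bot (Psi : flag Q) F : rk F = -1 -> sval Psi F.
Proof.
move=> rF.
have isbot G : rk G = -1 -> G = \bot%O.
  move=> rG; apply/eqP; apply: contrapT => /negP Gb.
  have : (\bot < G)%O by rewrite lt_neqAle le0x eq_sym Gb.
  by move=> /(rank_mono polyQ); have [? _] := rank_bounds \bot%O; lia.
have [||G PG rG] := flag_rank_ex Psi (i := -1) => //.
by rewrite (isbot F rF) -(isbot G rG).
Qed.

Lemma flag_top (Psi : flag Q) F : rk F = 3 -> sval Psi F.
Proof.
move=> rF.
have istop G : rk G = 3 -> G = \top%O.
  move=> rG; apply/eqP; apply: contrapT => /negP Gb.
  have : (G < \top)%O by rewrite lt_neqAle lex1 Gb.
  by move=> /(rank_mono polyQ); have [_ ?] := rank_bounds \top%O; lia.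
have [||G PG rG] := flag_rank_ex Psi (i := 3) => //.
by rewrite (istop F rF) -(istop G rG).
Qed.

Lemma rank_cases F : rk F = -1 \/ rk F = 0 \/ rk F = 1 \/ rk F = 2 \/ rk F = 3.
Proof. by have [? ?] := rank_bounds F; lia. Qed.

Lemma flag_eq (Psi Psi' : flag Q) :
  (forall i, 0 <= i -> i <= 2 ->
     exists F, [/\ rk F = i, sval Psi F & sval Psi' F]) -> Psi = Psi'.
Proof.
move=> H.
have sub (A B : flag Q) : (forall i, 0 <= i -> i <= 2 ->
     exists F, [/\ rk F = i, sval A F & sval B F]) -> sval A `<=` sval B.
  move=> HAB F AF; have [r|r] := pselect (0 <= rk F /\ rk F <= 2).
    have [G [rG AG BG]] := HAB (rk F) r.1 r.2.
    by rewrite -(flag_rank_inj AG AF rG).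
  case: (rank_cases F) => [|[h|[h|[h|]]]]; [exact: flag_bot| | | |exact: flag_top];
    by exfalso; apply: r; lia.
apply: flag_ext; apply/seteqP; split; apply: sub => // i i0 i2.
by have [F [? ? ?]] := H i i0 i2; exists F.
Qed.

Lemma adjacent_rank i (Psi Psi' : flag Q) F : i_adjacent rk i Psi Psi' ->
  sval Psi F -> sval Psi' F -> rk F <> i.
Proof.
move=> [ne adj] PF P'F rF; apply: ne; apply: flag_ext.
apply/seteqP; split=> G PG; have [rG|rG] := pselect (rk G = i).
- by rewrite -(flag_rank_inj PF PG) // rF rG.
- exact/adj.
- by rewrite -(flag_rank_inj P'F PG) // rF rG.
- exact/adj.
Qed.

Lemma adjacent_cases i (Psi Psi' : flag Q) : i_adjacent rk i Psi Psi' ->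
  i = 0 \/ i = 1 \/ i = 2.
Proof.
move=> adj; apply: contrapT => ni.
have [ne eqF] := adj; apply: ne; apply: flag_eq => j j0 j2.
have [||F PF rF] := flag_rank_ex Psi (i := j); [by lia|by lia|].
by exists F; split=> //; apply/eqF => // h; apply: ni; lia.
Qed.

(** By the diamond condition two faces of rank [i] lie between the faces of ranks i - 1 and i + 1.
    One belongs to [Psi], so both other flags contain the remaining one. *)
Lemma adjacent_uniq i (Psi Psi1 Psi2 : flag Q) : i_adjacent rk i Psi Psi1 ->
  i_adjacent rk i Psi Psi2 -> Psi1 = Psi2.
Proof.
move=> a1 a2; have ci := adjacent_cases a1.
have [||F PF rF] := flag_rank_ex Psi (i := i - 1); [by lia|by lia|].
have [||G PG rG] := flag_rank_ex Psi (i := i + 1); [by lia|by lia|].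
have [||H PH rH] := flag_rank_ex Psi (i := i); [by lia|by lia|].
have [||H1 PH1 rH1] := flag_rank_ex Psi1 (i := i); [by lia|by lia|].
have [||H2 PH2 rH2] := flag_rank_ex Psi2 (i := i); [by lia|by lia|].
have FH1 : (F < H1)%O.
  by apply: (@flag_lt Psi1) => //; [apply/a1.2 => //|]; lia.
have H1G : (H1 < G)%O.
  by apply: (@flag_lt Psi1) => //; [apply/a1.2 => //|]; lia.
have FH2 : (F < H2)%O.
  by apply: (@flag_lt Psi2) => //; [apply/a2.2 => //|]; lia.
have H2G : (H2 < G)%O.
  by apply: (@flag_lt Psi2) => //; [apply/a2.2 => //|]; lia.
have FH : (F < H)%O by apply: (@flag_lt Psi) => //; lia.
have HG : (H < G)%O by apply: (@flag_lt Psi) => //; lia.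
have H12 : H1 = H2.
  apply: (@card_two _ [set K : Q | (F < K)%O && (K < G)%O] H) => /=.
  - by apply: (diamond polyQ); [exact: lt_trans HG|lia].
  - by rewrite FH.
  - by rewrite FH1.
  - by rewrite FH2.
  - by move=> h; apply: (adjacent_rank a1 PH); rewrite -?h.
  - by move=> h; apply: (adjacent_rank a2 PH); rewrite -?h.
apply: flag_eq => j j0 j2; have [->|ji] := eqVneq j i; first by exists H1; rewrite {3}H12.
have [||K PK rK] := flag_rank_ex Psi (i := j); [by lia|by lia|].
by exists K; split=> //; [apply/a1.2 => //|apply/a2.2 => //]; rewrite rK; exact/eqP.
Qed.

End Flags.

(** * The local system of double cosets *)

Section Action.
Variables (d : Order.disp_t) (Q : tbPOrderType d) (rk : Q -> int)
  (Phi : flag Q) (Gamma : groupType) (r0 r1 r2 : Gamma)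
  (act : flag Q -> Gamma -> flag Q).
Hypotheses (polyQ : abstract_polyhedron rk)
  (scg : string_C_group r0 r1 r2) (fact : flag_action rk r0 r1 r2 act).

Let N := generated (vertex_words rk r1 r2 act Phi `|` face_words rk r0 r1 act Phi).

Let act1 := act_one fact.
Let actM := act_mul fact.

(** Pairs a generator with the rank that it changes, so that one argument serves all three. *)
Definition is_gen (i : int) (g : Gamma) : Prop :=
  [\/ i = 0 /\ g = r0, i = 1 /\ g = r1 | i = 2 /\ g = r2].

(** Generates the parabolic subgroup of the rho_j with [j] not a rank of a face in [S]; it moves
    flags through [S] to flags through [S]. *)
Definition gens_off (S : set Q) : set Gamma :=
  [set g | exists2 i, is_gen i g & forall F, S F -> rk F <> i].

Lemma act_gen i g Psi : is_gen i g -> i_adjacent rk i Psi (act Psi g).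
Proof.
by move=> [[-> ->]|[-> ->]|[-> ->]];
  [exact: (act_gen0 fact)|exact: (act_gen1 fact)|exact: (act_gen2 fact)].
Qed.

Lemma gen_invol i g : is_gen i g -> (g * g = 1)%g.
Proof.
by move=> [[_ ->]|[_ ->]|[_ ->]]; [case: (involution0 scg)|
  case: (involution1 scg)|case: (involution2 scg)].
Qed.

Lemma gen_fixfree i g Psi : is_gen i g -> act Psi g <> Psi.
Proof. by move=> /(act_gen Psi)[ne _] h; exact/ne/esym. Qed.

Lemma gen_keeps i g Psi F : is_gen i g -> rk F <> i -> sval Psi F ->
  sval (act Psi g) F.
Proof. by move=> /(act_gen Psi)[_ h] /h[]. Qed.

Lemma adjacent_act i g Psi Psi' : is_gen i g -> i_adjacent rk i Psi Psi' ->
  Psi' = act Psi g.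
Proof. by move=> /(act_gen Psi) a /(adjacent_uniq polyQ a). Qed.

Lemma gens_off_invol S a : gens_off S a -> (a * a = 1)%g.
Proof. by move=> [i /gen_invol]. Qed.

Lemma gens_off_keep S k Psi : generated (gens_off S) k -> S `<=` sval Psi ->
  S `<=` sval (act Psi k).
Proof.
move=> + SP; move: k; apply: generated_ind; first exact: gens_off_invol.
  by rewrite /= act1.
move=> y a [i ia iS] Sy F SF; rewrite actM.
by apply: (gen_keeps ia (iS _ SF)); exact: Sy.
Qed.

(** Strong flag-connectedness gives a path of flags containing [S]; each step changes a rank not
    occurring in [S] and is made by one generator. *)
Lemma gens_off_connect (S : set Q) Psi Psi' : S `<=` sval Psi ->
  S `<=` sval Psi' -> exists2 k, generated (gens_off S) k & act Psi k = Psi'.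
Proof.
move=> SP SP'.
have [m [Th [Th0 Thm adj common]]] := flag_connected polyQ Psi Psi'.
have ST k F : (k <= m)%N -> S F -> sval (Th k) F.
  by move=> km SF; apply: (common k km); split; [exact: SP|exact: SP'].
suff H k : (k <= m)%N -> exists2 g, generated (gens_off S) g & act Psi g = Th k.
  by rewrite -Thm; exact: H.
elim: k => [_|k IH km].
  by exists 1%g; [case: (generated_subgroup (gens_off S))|rewrite act1 Th0].
have [g Sg gk] := IH (ltnW km); have [i ai] := adj k km.
have [r ri] : exists r, is_gen i r.
  by case: (adjacent_cases polyQ ai) => [->|[->|->]];
    [exists r0; apply: Or31|exists r1; apply: Or32|exists r2; apply: Or33].
exists (g * r)%g; last by rewrite actM gk -(adjacent_act ri ai).
have [_ SM _] := generated_subgroup (gens_off S); apply: SM => //.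
apply: sub_generated; exists i => // F SF.
by apply: (adjacent_rank polyQ ai); apply: ST => //; exact: ltnW.
Qed.

Definition edge_of (Psi : flag Q) : Q :=
  xget \bot%O [set F | sval Psi F /\ rk F = 1].

Lemma edge_ofP Psi : sval Psi (edge_of Psi) /\ rk (edge_of Psi) = 1.
Proof.
rewrite /edge_of; have [||F PF rF] := flag_rank_ex polyQ Psi (i := 1) => //.
exact: (@xgetPex _ _ [set F | sval Psi F /\ rk F = 1]) (ex_intro _ F (conj PF rF)).
Qed.

Lemma edge_ofE Psi F : sval Psi F -> rk F = 1 -> edge_of Psi = F.
Proof.
by move=> PF rF; have [PE rE] := edge_ofP Psi; apply: (flag_rank_inj polyQ PE PF); rewrite rE.
Qed.

(* The case i = 0, j = 2 is the rotation about a vertex, the case i = 2, j = 0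
   the rotation about a face. *)
Section RotationAbout.
Variables (i j : int) (b : Gamma) (F : Q) (Ed : set Q).
Hypotheses (bj : is_gen j b) (rF : rk F = i)
  (ij : (i = 0 /\ j = 2) \/ (i = 2 /\ j = 0))
  (EdE : forall e, Ed e <-> rk e = 1 /\ ((F < e)%O || (e < F)%O)).

Let gen1 : is_gen 1 r1. Proof. exact: Or32. Qed.

Let Fl := [set Psi : flag Q | sval Psi F].

Lemma gens_off_face : generated (gens_off [set F]) `<=` generated [set r1; b].
Proof.
apply: generated_mono => g [k + /(_ F erefl)]; rewrite rF => kg ki.
by move: bj ij ki kg => [[-> ->]|[-> ->]|[-> ->]] [[-> ?]|[-> ?]] // ki
  [[? ->]|[? ->]|[? ->]]; subst=> //; [right|left|left|right].
Qed.

(** Supplies the hypotheses of the abstract rotation lemmas for the flags through [F]. Two of these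
    flags with the same edge can differ only in rank [j]. *)
Lemma rotation_hyps : [/\ forall Psi, Fl Psi -> Fl (act Psi r1),
  forall Psi, Fl Psi -> Fl (act Psi b),
  forall Psi Psi', Fl Psi -> Fl Psi' ->
     exists2 k, generated [set r1; b] k & act Psi k = Psi',
  forall Psi, Fl Psi -> Ed (edge_of Psi) &
  [/\ forall e, Ed e -> exists2 Psi, Fl Psi & edge_of Psi = e,
      forall Psi, Fl Psi -> edge_of (act Psi b) = edge_of Psi &
      forall Psi Psi', Fl Psi -> Fl Psi' -> edge_of Psi = edge_of Psi' ->
        Psi' = Psi \/ Psi' = act Psi b]].
Proof.
split; last split.
- by move=> Psi; apply: (gen_keeps gen1); rewrite rF; lia.
- by move=> Psi; apply: (gen_keeps bj); rewrite rF; lia.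
- move=> Psi Psi' PF PF'.
  have [||k Sk <-] := @gens_off_connect [set F] Psi Psi'; try by move=> ? ->.
  by exists k => //; exact: gens_off_face.
- move=> Psi PF; have [PE rE] := edge_ofP Psi; apply/EdE; split=> //.
  by case: ij => -[? _]; apply/orP; [left|right]; apply: (flag_lt polyQ (Psi := Psi)) => //; lia.
- move=> e /EdE[re Fe].
  have [|Psi PS] := @flag_extend _ _ [set F; e].
    by move=> x y [->|->] [->|->]; rewrite ?lexx; auto;
      case/orP: Fe => /ltW ->; auto.
  by exists Psi; [apply: PS; left|apply: edge_ofE => //; apply: PS; right].
- move=> Psi _; have [PE rE] := edge_ofP Psi; apply: edge_ofE => //.
  by apply: (gen_keeps bj) => //; rewrite rE; lia.
- move=> Psi Psi' PF PF' eE; have [->|ne] := pselect (Psi = Psi'); first by left.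
  right; apply: (adjacent_act bj); split=> // G rG.
  have [PE rE] := edge_ofP Psi; have [PE' _] := edge_ofP Psi'.
  have [rGF|rGF] := pselect (rk G = i).
    by split=> PG; rewrite -(flag_rank_inj polyQ _ PG (F := F)) // rGF.
  have [rGE|rGE] := pselect (rk G = 1).
    split=> PG.
      by rewrite -(flag_rank_inj polyQ PE PG) ?rE // eE.
    by rewrite -(flag_rank_inj polyQ PE' PG) -?eE // rE.
  case: (rank_cases polyQ G) => [|[h|[h|[h|]]]] => [h|||| h]; try lia.
    by split=> _; exact: (flag_bot polyQ).
  by split=> _; exact: (flag_top polyQ).
Qed.

Lemma rotation_face_card Psi q : sval Psi F -> Ed #= `I_q ->
  act Psi ((r1 * b) ^+ q)%g = Psi.
Proof.
have [h1 h2 h3 h4 [h5 h6 h7]] := rotation_hyps => PF.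
apply: (rotation_card actM act1 (gen_invol gen1) (gen_invol bj) _ _ h1 h2 h3 h4 h5 h6 h7) => // *.
- exact: gen_fixfree gen1.
- exact: gen_fixfree bj.
Qed.

(** Reflections fix no flag, so [k] is a power of the rotation or the inverse of one, and its
    exponent is a multiple of the period. The alternative [l = 0] covers the identity, where [Ed]
    may be infinite. *)
Lemma rotation_face_stab Psi k : sval Psi F ->
  generated (gens_off [set F]) k -> act Psi k = Psi ->
  exists q l, (Ed #= `I_q \/ l = 0%N) /\
    (k = ((r1 * b) ^+ q ^+ l)%g \/ k = ((r1 * b) ^+ q ^+ l)^-1%g).
Proof.
have fr1 x : act x r1 <> x by exact: gen_fixfree gen1.
have frb x : act x b <> x by exact: gen_fixfree bj.
have i1 := gen_invol gen1; have ib := gen_invol bj.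
have [h1 h2 h3 h4 [h5 h6 h7]] := rotation_hyps => PF.
move=> /gens_off_face /(dihedral_elements i1 ib) [[m km]|[m km]] fk; last first.
  exfalso; case: km fk => ->; first exact: reflection_fixfree.
  exact: reflection_fixfree.
have fm : act Psi ((r1 * b) ^+ m)%g = Psi.
  by case: km fk => -> // h; rewrite -{1}h -actM mulVg act1.
case: (posnP m) => [m0|m0].
  by exists 0%N, 0%N; split; [right|move: km; rewrite m0].
have [q [l [Eq ml _]]] := rotation_period actM act1 i1 ib fr1 frb h1 h2 h3 h4 h5 h6 h7 PF m0 fm.
by exists q, l; split; [left|rewrite -expgnA -ml].
Qed.

End RotationAbout.

Lemma vertex_edges v : rk v = 0 -> forall e, edges_at rk v e <->
  rk e = 1 /\ ((v < e)%O || (e < v)%O).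
Proof.
move=> rv e; split=> [[re ve]|[re /orP[ve|/(rank_mono polyQ)]]] //; last lia.
by rewrite ve.
Qed.

Lemma face_edges f : rk f = 2 -> forall e, edges_of rk f e <->
  rk e = 1 /\ ((f < e)%O || (e < f)%O).
Proof.
move=> rf e; split=> [[re ve]|[re /orP[/(rank_mono polyQ)|ve]]] //; last lia.
by rewrite ve orbT.
Qed.

Let gen0 : is_gen 0 r0. Proof. exact: Or31. Qed.
Let gen1 : is_gen 1 r1. Proof. exact: Or32. Qed.
Let gen2 : is_gen 2 r2. Proof. exact: Or33. Qed.

Lemma N_subgroup : subgroup N. Proof. exact: generated_subgroup. Qed.

Lemma N_stab n : N n -> act Phi n = Phi.
Proof.
move: n; apply: generated_min.
  split=> [|x y hx hy|x hx] /=; first exact: act1.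
    by rewrite actM hx.
  by rewrite -{1}hx -actM mulgV act1.
move=> _ [[v [q [w [rv cv wv ->]]]]|[f [p [w [rf cf wf ->]]]]] /=; rewrite 2!actM.
  rewrite (rotation_face_card gen2 rv _ (vertex_edges rv) wv cv); last by left.
  by rewrite -actM mulgV act1.
(* The rotation lemma concerns (r1 r0)^p, the inverse of the rotation in a face word. *)
rewrite expg_invol; [|exact: gen_invol gen1|exact: gen_invol gen0].
set t := ((r1 * r0) ^+ p)%g.
have := rotation_face_card gen0 rf _ (face_edges rf) wf cf.
move=> /(_ (or_intror (conj erefl erefl))) h.
by rewrite -{1}h -(actM (act Phi w)) mulgV act1 -actM mulgV act1.
Qed.

(* The stabilizer of a flag in the group generated by the two generators fixing
   one of its faces is generated by a full rotation about that face. *)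
Lemma face_stab (F : Q) w k : proper_face rk F -> sval (act Phi w) F ->
  generated (gens_off [set F]) k -> act (act Phi w) k = act Phi w ->
  N (w * k * w^-1)%g.
Proof.
move=> /andP[F0 F2] wF Sk fk; have [N1 NM NV] := N_subgroup.
have NX x l : N x -> N (x ^+ l)%g.
  by move=> Nx; elim: l => // l IH; rewrite expgS; exact: NM.
have conjX x l : (w * x ^+ l * w^-1 = (w * x * w^-1) ^+ l)%g.
  elim: l => [|l IH]; first by rewrite mulg1 mulgV.
  by rewrite expgS [in RHS]expgS -IH !mulgA mulgVK.
have conjV x : (w * x^-1 * w^-1 = (w * x * w^-1)^-1)%g.
  by rewrite !invgM invgK mulgA.
have [rF|[rF|rF]] : rk F = 0 \/ rk F = 1 \/ rk F = 2 by lia.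
- have [|q [l [Eq kE]]] := rotation_face_stab gen2 rF _ (vertex_edges rF) wF Sk fk.
    by left.
  have Nl : N (w * ((r1 * r2) ^+ q) ^+ l * w^-1)%g.
    case: Eq => [Eq|->]; last by rewrite mulg1 mulgV.
    by rewrite conjX; apply: NX; apply: sub_generated; left; exists F, q, w.
  by case: kE => -> //; rewrite conjV; exact: NV.
(* About an edge the group consists of 1, r0, r2 and r0 r2, by the string relation, and only 1 fixes
   a flag. *)
- have sub : generated (gens_off [set F]) `<=` generated [set r0; r2].
    apply: generated_mono => g [i ig /(_ F erefl)]; rewrite rF.
    by case: ig => -[-> ->] // _; [left|right].
  have r00 := gen_invol gen0; have r22 := gen_invol gen2.
  have r02 : (r0 * r2 * (r0 * r2) = 1)%g by have := string_relation scg.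
  have : [\/ k = 1, k = r0, k = r2 | k = r0 * r2]%g.
    move: (sub _ Sk) => {Sk fk}; move: k; apply: generated_ind.
    - by move=> a [->|->].
    - exact: Or41.
    have r20 : (r2 * r0 = r0 * r2)%g.
      by rewrite -[LHS]mul1g -r02 !mulgA -(mulgA _ r2 r2) r22 mulg1 -(mulgA _ r0 r0) r00 mulg1.
    move=> y a [->|->] [->|->|->|->]; rewrite ?mul1g.
    + exact: Or42.
    + by rewrite r00; exact: Or41.
    + by rewrite r20; exact: Or44.
    + by rewrite -mulgA r20 mulgA r00 mul1g; exact: Or43.
    + exact: Or43.
    + exact: Or44.
    + by rewrite r22; exact: Or41.
    + by rewrite -mulgA r22 mulg1; exact: Or42.
  move=> [] kE; move: fk; rewrite kE.
  + by rewrite mulg1 mulgV.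
  + by move/(gen_fixfree gen0).
  + by move/(gen_fixfree gen2).
  (* Otherwise [r0] and [r2] would send the flag to the same flag, yet [r0] changes its vertex and
     [r2] keeps it. *)
  + move=> h; exfalso; set Psi := act Phi w in h.
    have h' : act Psi r0 = act Psi r2 by rewrite -[in RHS]h -actM -mulgA r22 mulg1.
    have [||v Pv rv] := flag_rank_ex polyQ Psi (i := 0) => //.
    apply: (adjacent_rank polyQ (act_gen Psi gen0) Pv) => //.
    by rewrite h'; apply: (gen_keeps gen2) => //; rewrite rv.
- have [|q [l [Eq kE]]] := rotation_face_stab gen0 rF _ (face_edges rF) wF Sk fk.
    by right.
  have Nl : N (w * ((r1 * r0) ^+ q) ^+ l * w^-1)%g.
    case: Eq => [Eq|->]; last by rewrite mulg1 mulgV.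
    rewrite conjX; apply: NX.
    rewrite expg_invol; [|exact: gen_invol gen0|exact: gen_invol gen1].
    by rewrite conjV; apply: NV; apply: sub_generated; right; exists F, q, w.
  by case: kE => -> //; rewrite conjV; exact: NV.
Qed.

(** When Phi^w contains [F], this is a component of the flags through [F] in the covering by cosets
    of [N], written as a set of group elements. *)
Definition double_coset (F : Q) (w : Gamma) : set Gamma :=
  [set x | exists n k, [/\ N n, generated (gens_off [set F]) k & x = (n * w * k)%g]].

Lemma double_coset_id F w : double_coset F w w.
Proof.
exists 1%g, 1%g; rewrite mul1g mulg1; split=> //; first by case: N_subgroup.
by case: (generated_subgroup (gens_off [set F])).
Qed.

Lemma double_coset_mul F w k : generated (gens_off [set F]) k ->
  double_coset F w (w * k)%g.
Proof. by move=> Fk; exists 1%g, k; rewrite mul1g; split=> //; case: N_subgroup. Qed.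

Lemma double_coset_eq F w x : double_coset F w x ->
  double_coset F x = double_coset F w.
Proof.
have [N1 NM NV] := N_subgroup.
have [K1 KM KV] := generated_subgroup (gens_off [set F]).
move=> [n [k [Nn Kk ->]]]; apply/seteqP; split=> y [n' [k' [Nn' Kk' ->]]].
  exists (n' * n)%g, (k * k')%g; split; [exact: NM|exact: KM|].
  by rewrite !mulgA.
exists (n' * n^-1)%g, (k^-1 * k')%g; split; [by apply: NM => //; exact: NV|by apply: KM => //; exact: KV|].
by rewrite !mulgA mulgK mulgVK.
Qed.

Lemma double_coset_face F w x : sval (act Phi w) F -> double_coset F w x ->
  sval (act Phi x) F.
Proof.
move=> wF [n [k [Nn Kk ->]]]; rewrite 2!actM (N_stab Nn).
by apply: (gens_off_keep Kk) => // ? ->.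
Qed.

(** Some [l] keeping both [F] and [G] leads from Phi^x to Phi^y. With y = n x k, the element k l^-1
    fixes Phi^x and keeps [F], so [face_stab] puts x k l^-1 x^-1 in [N], and [y] lies in N x l. *)
Lemma double_coset_change F G x y : proper_face rk F ->
  sval (act Phi x) F -> sval (act Phi x) G -> sval (act Phi y) G ->
  double_coset F x y -> double_coset G x y.
Proof.
move=> pF xF xG yG Fxy; have yF := double_coset_face xF Fxy.
have [n [k [Nn Kk yE]]] := Fxy.
have [||l Kl lE] := @gens_off_connect [set F; G] (act Phi x) (act Phi y).
- by move=> ? [->|->].
- by move=> ? [->|->].
have [N1 NM NV] := N_subgroup.
have [_ KM KV] := generated_subgroup (gens_off [set F]).
have sub H : [set F; G] H -> generated (gens_off [set F; G]) `<=` generated (gens_off [set H]).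
  by move=> FGH; apply: generated_mono => g [i ig h]; exists i => // K ->; exact: h.
have Ns : N (x * (k * l^-1) * x^-1)%g.
  apply: (face_stab pF xF); first by apply: KM => //; apply: KV; apply: (sub F) => //; left.
  rewrite actM; have -> : act (act Phi x) k = act Phi y.
    by rewrite yE 2!actM (N_stab Nn).
  by rewrite -lE -actM mulgV act1.
exists (n * (x * (k * l^-1) * x^-1))%g, l; split; [exact: NM| |].
  by apply: (sub G) => //; right.
by rewrite yE !mulgA mulgVK mulgVK.
Qed.

Let P := {F : Q | proper_face rk F}.
Let le (F G : P) : Prop := (sval F <= sval G)%O.

Definition coset_fiber (F : P) : set (set Gamma) :=
  [set C | exists2 w, sval (act Phi w) (sval F) & C = double_coset (sval F) w].

(** The transport relation: a common element is a lifted flag through both faces. *)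
Definition cosets_meet (C D : set Gamma) : Prop := C `&` D !=set0.

Lemma coset_fiberE (F : P) C x : coset_fiber F C -> C x ->
  sval (act Phi x) (sval F) /\ C = double_coset (sval F) x.
Proof.
move=> [w wF ->] wx; split; first exact: double_coset_face wx.
exact/esym/double_coset_eq.
Qed.

Lemma coset_uniq (F G : P) C D D' : coset_fiber F C -> coset_fiber G D ->
  coset_fiber G D' -> cosets_meet C D -> cosets_meet C D' -> D = D'.
Proof.
move=> FC GD GD' [x [Cx Dx]] [y [Cy Dy]].
have [xF CE] := coset_fiberE FC Cx; have [xG DE] := coset_fiberE GD Dx.
have [yG DE'] := coset_fiberE GD' Dy.
rewrite DE DE'; apply/esym/double_coset_eq.
by apply: (@double_coset_change (sval F)) => //; [exact: svalP|rewrite -CE].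
Qed.

(** The parabolic subgroup of [F] is transitive on the flags through [F], so a component contains a
    lift of each of them, in particular of one through [S]. *)
Lemma coset_extend (F : P) C (S : set Q) : coset_fiber F C -> S (sval F) ->
  chain S -> exists2 x, C x & S `<=` sval (act Phi x).
Proof.
move=> [w wF ->] SF chS; have [Psi SP] := flag_extend chS.
have [||k Kk kE] := @gens_off_connect [set sval F] (act Phi w) Psi.
- by move=> ? ->.
- by move=> ? ->; exact: SP.
by exists (w * k)%g; [exact: double_coset_mul|rewrite actM kE].
Qed.

(** A component has a representative whose flag passes through all the comparable faces in question;
    the double cosets of that one element give the lifts and their compatibility. *)
Lemma coset_system : local_system le coset_fiber cosets_meet.
Proof.
split.
- by move=> F C [w _ ->]; exists w; split; exact: double_coset_id.
- by move=> C D [x [? ?]]; exists x.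
- move=> F G C FG FC.
  have [||x Cx xS] := coset_extend FC (S := [set sval F; sval G]); first by left.
    move=> y z [->|->] [->|->]; rewrite ?lexx; auto.
    by case: FG => FG; [right|left].
  exists (double_coset (sval G) x); first by exists x => //; apply: xS; right.
  by exists x; split=> //; exact: double_coset_id.
- by move=> F G C D D' _; exact: coset_uniq.
- move=> F G K C D D' FG GK FK FC GD KD' CD CD'.
  have [||x Cx xS] := coset_extend FC (S := [set sval F; sval G; sval K]).
  + by left; left.
  + by move=> y z [[->|->]|->] [[->|->]|->]; rewrite ?lexx; auto.
  have xG : sval (act Phi x) (sval G) by apply: xS; left; right.
  have xK : sval (act Phi x) (sval K) by apply: xS; right.
  have -> : D = double_coset (sval G) x.
    apply: (coset_uniq FC GD _ CD); first by exists x.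
    by exists x; split=> //; exact: double_coset_id.
  have -> : D' = double_coset (sval K) x.
    apply: (coset_uniq FC KD' _ CD'); first by exists x.
    by exists x; split=> //; exact: double_coset_id.
  by exists x; split; exact: double_coset_id.
Qed.

(** The family through the double coset of 1 selects one sheet: by induction on words every [x] lies
    in [s F] for each proper face [F] of Phi^x. Hence [g] in the stabilizer is n k with [k] keeping
    [F0] and fixing Phi, and [face_stab] puts [k] in [N]. *)
Lemma stabilizer_of_family :
  (forall (F0 : P) C0, coset_fiber F0 C0 -> exists s : P -> set Gamma,
    [/\ forall F, coset_fiber F (s F), s F0 = C0 &
        forall F G, le F G -> cosets_meet (s F) (s G)]) ->
  stabilizer act Phi = N.
Proof.
move=> family; apply/seteqP; split=> [g /= gPhi|]; last exact: N_stab.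
have facei (Psi : flag Q) (i : int) : 0 <= i -> i <= 2 -> exists2 F : P, sval Psi (sval F) & rk (sval F) = i.
  move=> i0 i2; have [||F PF rF] := flag_rank_ex polyQ Psi (i := i); [lia|lia|].
  have pF : proper_face rk F by rewrite /proper_face rF i0 i2.
  by exists (exist _ F pF).
have [||F0 PF0 _] := facei Phi 0 => //.
have [|s [sF s0 sle]] := family F0 (double_coset (sval F0) 1%g).
  by exists 1%g => //; rewrite act1.
(* Transport within the family passes membership from one face of a flag to the others. *)
have spread (F G : P) x : sval (act Phi x) (sval F) -> sval (act Phi x) (sval G) ->
    s F x -> s G x.
  move=> xF xG sx; have [_ sE] := coset_fiberE (sF F) sx.
  have -> : s G = double_coset (sval G) x.
    apply: (coset_uniq (sF F) (sF G)); first by exists x.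
      case: (flag_le xF xG) => h; first exact: sle.
      by have [y [? ?]] := sle G F h; exists y.
    by exists x; split=> //; exact: double_coset_id.
  exact: double_coset_id.
have all x (F : P) : sval (act Phi x) (sval F) -> s F x.
  have : generated [set r0; r1; r2] x by rewrite (generators scg).
  move: x F; suff H : generated [set r0; r1; r2] `<=`
      [set x | forall F : P, sval (act Phi x) (sval F) -> s F x].
    by move=> x F /H; apply.
  apply: generated_ind.
  - by move=> a [[->|->]|->]; [exact: gen_invol gen0|exact: gen_invol gen1|exact: gen_invol gen2].
  - move=> F; rewrite act1 => PF; apply: (spread F0); rewrite ?act1 //.
    by rewrite s0; exact: double_coset_id.
  move=> y a ha sy F aF.
  have [i ia] : exists i, is_gen i a.
    by case: ha => [[->|->]|->]; [exists 0|exists 1|exists 2].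
  (* The generator [a] keeps the face of some rank [j] other than [i], and [y] and y a lie in the
     same double coset of that face. *)
  have [j [j0 j2 ji]] : exists j : int, [/\ 0 <= j, j <= 2 & j <> i].
    by have [->|] := eqVneq i 0; [exists 1|move=> h; exists 0; split=> //; lia].
  have [F1 yF1 rF1] := facei (act Phi y) j j0 j2.
  apply: (spread F1) => //.
    by rewrite actM; apply: (gen_keeps ia) => //; rewrite rF1.
  have sy1 := sy F1 yF1; have [_ ->] := coset_fiberE (sF F1) sy1.
  apply: double_coset_mul; apply: sub_generated; exists i => // K ->.
  by rewrite rF1.
have : s F0 g by apply: all; rewrite gPhi.
rewrite s0 => -[n [k [Nn Kk gE]]].
have [_ NM _] := N_subgroup.
rewrite -/N gE mulg1; apply: (NM n k) => //.
have := face_stab (F := sval F0) (w := 1%g) (k := k) (svalP F0).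
rewrite !act1 mul1g invg1 mulg1; apply=> //.
by rewrite -[RHS]gPhi gE mulg1 actM (N_stab Nn).
Qed.

End Action.

Theorem theorem3p4 (R : realType) (d : Order.disp_t) (Q : tbPOrderType d)
    (rk : Q -> int) (Phi : flag Q) (Gamma : groupType) (r0 r1 r2 : Gamma)
    (act : flag Q -> Gamma -> flag Q) :
  abstract_polyhedron rk ->
  map_on R rk (unit_sphere R) \/ map_on R rk (euclidean_plane R) ->
  string_C_group r0 r1 r2 ->
  flag_action rk r0 r1 r2 act ->
  stabilizer act Phi =
    generated (vertex_words rk r1 r2 act Phi `|` face_words rk r0 r1 act Phi).
Proof.
move=> polyQ mapQ scg fact; apply: (stabilizer_of_family polyQ scg fact).
have sysP := coset_system Phi polyQ scg fact.
have tr (F G K : {F : Q | proper_face rk F}) :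
  (sval F <= sval G)%O -> (sval G <= sval K)%O -> (sval F <= sval K)%O.
  exact: le_trans.
move=> F0 C0 FC0; case: mapQ => mapQ.
  apply: (global_family sysP mapQ _ FC0) => c; exact: (has_sections_unit_sphere sysP tr).
apply: (global_family sysP mapQ _ FC0) => c; exact: (has_sections_euclidean_plane sysP tr).
Qed.
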